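(* Let $L^p \subset \mathbb{R}^n$ be a smooth $p$-dimensional submanifold, let $q = n-p$, and let $\mu$ be a smooth $1$-form on $L$ with $d\mu = 0$ (so that $X_\mu$ is Lagrangian in $T^*\mathbb{R}^n \cong \mathbb{C}^n$), where $$X_\mu = \{(x, \xi + \mu_x) \in T^*\mathbb{R}^n|_L : x \in L,\ \xi \in N^*_xL\}.$$ Let $B$ be the symmetric matrix $$B_{ij} = (\nabla_{e_i}\mu)(e_j) = \tfrac12\left((\nabla_{e_i}\mu)(e_j) + (\nabla_{e_j}\mu)(e_i)\right)$$ with respect to a local orthonormal tangent frame $\{e_1,\dots,e_p\}$ of $L$. Let $\theta \in \mathbb{R}$ and let $\phi = \frac{\pi}{2}q - \theta$. Then $X_\mu$ is special Lagrangian with phase $e^{i\theta}$ if and only if at every point of $L$ $$\mathrm{Im}\left(e^{i\phi}\det(I + iB)\right) = 0$$ and $$\sigma_j\left(A^\nu (I+iB)^{-1}\right) = (-1)^j\, \sigma_j\left(A^\nu (I-iB)^{-1}\right) \qquad \text{for all } j = 1,\dots,p,$$ for every normal vector field $\nu$ on $L$, where $A^\nu$ is the (matrix of the) second fundamental form of $L$ in the direction $\nu$.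
   Context: $\nabla$ is the Levi-Civita connection of Euclidean $\mathbb{R}^n$. $N^*L \subset T^*\mathbb{R}^n|_L$ is the conormal bundle of $L$. Using the Euclidean metric, $T^*\mathbb{R}^n|_L = T^*L \oplus N^*L$ orthogonally, and a $1$-form $\mu$ on $L$ is regarded as a section of $T^*\mathbb{R}^n|_L$ lying in $T^*L$. For $e_i, e_j$ tangent to $L$, $(\nabla_{e_i}\mu)(e_j)$ agrees with the covariant derivative of $\mu$ for the induced Levi-Civita connection of $L$; since $d\mu=0$, it is symmetric in $i,j$. For a normal vector field $\nu$ on $L$, the second fundamental form in the direction $\nu$ is $A^\nu(w) = (\nabla_w \nu)^T$ (tangential part) for $w$ tangent to $L$, with matrix $A^\nu_{ij} = \langle A^\nu(e_i), e_j\rangle$ in the same orthonormal frame $\{e_1,\dots,e_p\}$ used for $B$. For a $p\times p$ (complex) matrix $C$, the elementary symmetric polynomials $\sigma_k(C)$ are defined by $\det(I+tC) = \sum_{k=0}^p t^k \sigma_k(C)$. $T^*\mathbb{R}^n \cong \mathbb{C}^n$ via $z^k = x^k + i\xi_k$, where $x^k$ are Euclidean coordinates and $\xi_k$ the corresponding fibre coordinates, with symplectic form $\omega = \sum_k dx^k\wedge d\xi_k$ and holomorphic volume form $\Omega = dz^1\wedge\cdots\wedge dz^n$. An $n$-dimensional submanifold $X$ is Lagrangian if $\omega|_X = 0$, and is special Lagrangian with phase $e^{i\theta}$ if it is Lagrangian and $\mathrm{Im}(e^{-i\theta}\Omega)|_X = 0$ (so the phase is considered up to sign, which corresponds to a choice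 of orientation). *)

(* Defs.v *)
From HB Require Import structures.
From mathcomp Require Import all_boot all_order all_algebra.
From mathcomp Require Import all_classical all_reals all_analysis.
From mathcomp Require Export complex.

Set Implicit Arguments.
Unset Strict Implicit.
Unset Printing Implicit Defensive.

Import Order.TTheory GRing.Theory Num.Theory.
Import numFieldNormedType.Exports.

Local Open Scope classical_set_scope.
Local Open Scope ring_scope.

Section Euclidean.
Variable R : realType.

Definition dot n (u v : 'rV[R]_n) : R := \sum_(k < n) u 0 k * v 0 k.

Fixpoint Ck k (V W : normedModType R) (U : set V) (f : V -> W) : Prop :=
  match k with
  | 0 => forall x, U x -> {for x, continuous f}
  | k'.+1 => (forall x, U x -> differentiable f x) /\
             (forall v, Ck k' U (fun x => 'd f x v))
  end.

Definition smooth (V W : normedModType R) (U : set V) (f : V -> W) : Prop :=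
  forall k, Ck k U f.

(* Inverse charts of a subset L of R^m: smooth immersions of an open subset V
   of R^p that are homeomorphisms onto a relatively open subset of L.  The last
   clause says that phi is open as a map from V to L. *)
Record parametrization p m (L : set 'rV[R]_m) (V : set 'rV[R]_p)
    (phi : 'rV[R]_p -> 'rV[R]_m) : Prop := Parametrization {
  param_open : open V;
  param_smooth : smooth V phi;
  param_immersion : forall a, V a -> injective ('d phi a);
  param_inj : {in V &, injective phi};
  param_openmap : forall W : set 'rV[R]_p, open W -> W `<=` V ->
    exists2 U : set 'rV[R]_m, open U & phi @` W = L `&` U }.

(* Embedded submanifolds of R^m, without boundary. *)
Definition submanifold p m (L : set 'rV[R]_m) : Prop :=
  forall x, L x -> exists (V : set 'rV[R]_p) phi a,
    [/\ parametrization L V phi, V a & phi a = x].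

Definition tangent p m (L : set 'rV[R]_m) (x w : 'rV[R]_m) : Prop :=
  exists (V : set 'rV[R]_p) phi a u,
    [/\ parametrization L V phi, V a, phi a = x & 'd phi a u = w].

(* Covectors of R^m are given by their coordinates, so that dot is also the
   pairing of a covector with a vector, and this predicate describes both the
   normal space and the conormal space of L at x. *)
Definition normal_at p m (L : set 'rV[R]_m) (x nu : 'rV[R]_m) : Prop :=
  forall w, tangent p L x w -> dot nu w = 0.

(* Only the values of f on L matter. *)
Definition smooth_along p m (L : set 'rV[R]_m) (f : 'rV[R]_m -> 'rV[R]_m) :=
  forall (V : set 'rV[R]_p) phi, parametrization L V phi ->
    smooth V (f \o phi).

(* The Euclidean covariant derivative, in the direction w tangent to L at x, of
   an R^m-valued function f on L: the derivative of f o phi along u, where phi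
   is a parametrization and dphi(u) = w.  The value does not depend on phi when
   f is smooth along L. *)
Definition nabla p m (L : set 'rV[R]_m) (f : 'rV[R]_m -> 'rV[R]_m)
    (x w : 'rV[R]_m) : 'rV[R]_m :=
  get [set d | exists (V : set 'rV[R]_p) phi a u,
    [/\ parametrization L V phi, V a, phi a = x, 'd phi a u = w &
        'd (f \o phi) a u = d]].

(* A 1-form on L is seen as a section over L of the cotangent bundle of R^m
   lying in T^*L, which the metric identifies with the annihilator of the
   normal spaces. *)
Definition one_form p m (L : set 'rV[R]_m) (mu : 'rV[R]_m -> 'rV[R]_m) : Prop :=
  smooth_along p L mu /\ (forall x, L x -> tangent p L x (mu x)).

Definition pullback p m (phi : 'rV[R]_p -> 'rV[R]_m)
    (mu : 'rV[R]_m -> 'rV[R]_m) (a u : 'rV[R]_p) : R :=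
  dot (mu (phi a)) ('d phi a u).

(* alpha a is the linear form at a, and v, w are constant vector fields. *)
Definition ext_deriv p (alpha : 'rV[R]_p -> 'rV[R]_p -> R)
    (a v w : 'rV[R]_p) : R :=
  'D_v (fun b => alpha b w : R^o) a - 'D_w (fun b => alpha b v : R^o) a.

Definition closed_form p m (L : set 'rV[R]_m) (mu : 'rV[R]_m -> 'rV[R]_m) :=
  forall (V : set 'rV[R]_p) phi, parametrization L V phi ->
    forall a, V a -> forall v w, ext_deriv (pullback phi mu) a v w = 0.

Definition normal_field p m (L : set 'rV[R]_m) (nu : 'rV[R]_m -> 'rV[R]_m) :=
  smooth_along p L nu /\ (forall x, L x -> normal_at p L x (nu x)).

Definition tangential_part p m (L : set 'rV[R]_m) (x w : 'rV[R]_m) :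
    'rV[R]_m :=
  get [set v | tangent p L x v /\ normal_at p L x (w - v)].

Definition second_fundamental_form p m (L : set 'rV[R]_m)
    (nu : 'rV[R]_m -> 'rV[R]_m) (x w : 'rV[R]_m) : 'rV[R]_m :=
  tangential_part p L x (nabla p L nu x w).

(* The rows of e x are the frame at x.  No continuity in x is required: the
   matrices below at x depend only on e x, and every orthonormal basis of a
   tangent space extends to a smooth local frame. *)
Definition orthonormal_frame p m (L : set 'rV[R]_m)
    (e : 'rV[R]_m -> 'M[R]_(p, m)) : Prop :=
  forall x, L x ->
    (forall i, tangent p L x (row i (e x))) /\
    (forall i j, dot (row i (e x)) (row j (e x)) = (i == j)%:R).

Definition Amx p m (L : set 'rV[R]_m) (e : 'rV[R]_m -> 'M[R]_(p, m))
    (nu : 'rV[R]_m -> 'rV[R]_m) (x : 'rV[R]_m) : 'M[R]_p :=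
  \matrix_(i, j)
    dot (second_fundamental_form p L nu x (row i (e x))) (row j (e x)).

Definition Bmx p m (L : set 'rV[R]_m) (e : 'rV[R]_m -> 'M[R]_(p, m))
    (mu : 'rV[R]_m -> 'rV[R]_m) (x : 'rV[R]_m) : 'M[R]_p :=
  \matrix_(i, j) dot (nabla p L mu x (row i (e x))) (row j (e x)).

End Euclidean.

Section SpecialLagrangian.
Variables (R : realType) (n : nat).

(* A point or vector of T^*R^n = R^n x R^n is row_mx x xi. *)
Implicit Types (u v : 'rV[R]_(n + n)) (X : set 'rV[R]_(n + n)).

Definition expi (t : R) : R[i] := (cos t +i* sin t)%C.

Definition zcoord u (k : 'I_n) : R[i] := (lsubmx u 0 k +i* rsubmx u 0 k)%C.

Definition omega u v : R :=
  \sum_(k < n) (lsubmx u 0 k * rsubmx v 0 k - rsubmx u 0 k * lsubmx v 0 k).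

Definition Omega (v : 'I_n -> 'rV[R]_(n + n)) : R[i] :=
  \det (\matrix_(k, j) zcoord (v j) k).

Definition lagrangian X : Prop :=
  submanifold n X /\
  (forall z, X z -> forall u v, tangent n X z u -> tangent n X z v ->
     omega u v = 0).

Definition special_lagrangian (theta : R) X : Prop :=
  lagrangian X /\
  (forall z, X z -> forall v : 'I_n -> 'rV[R]_(n + n),
     (forall j, tangent n X z (v j)) ->
     complex.Im (expi (- theta) * Omega v) = 0).

Definition twisted_conormal p (L : set 'rV[R]_n)
    (mu : 'rV[R]_n -> 'rV[R]_n) : set 'rV[R]_(n + n) :=
  [set z | exists x xi,
     [/\ L x, normal_at p L x xi & z = row_mx x (xi + mu x)]].

End SpecialLagrangian.

Definition sigma (K : comNzRingType) p (k : nat) (C : 'M[K]_p) : K :=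
  (\det (1%:M + 'X *: map_mx polyC C))`_k.

Definition toC (R : realType) p (M : 'M[R]_p) : 'M[R[i]]_p :=
  map_mx (real_complex R) M.

(* Main.v *)
(* Write P for the orthogonal projection of R^n onto T_xL, in the frame e given
   by e^T e.  At the point (x, xi + mu_x) the tangent space of X_mu is the row
   space of [P | e^T S e + (1 - P)] with S = A^nu + B, where nu is any normal
   field with nu(x) = xi: differentiating <nu, dphi(w)> = 0 shows that
   A^nu = - <nu, d^2 phi> depends on nu(x) only, and is linear in it.  On this
   basis the form omega vanishes because S is symmetric (Schwarz for A,
     closedness
   of mu for B), and Omega equals i^q det(I + i(A^nu + B)).  Replacing nu by t
     nu,
   the phase condition says that the polynomial
     Im (e^{i phi} det(I + iB) sum_j (it)^j sigma_j(A^nu (I + iB)^-1))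
   vanishes for all real t; its constant term makes e^{i phi} det(I + iB) real,
   and nonzero since B is real symmetric,
     so that the other coefficients say that
   i^j sigma_j(A^nu (I + iB)^-1) is real.

   The projection xi |-> xi (1 - P) is smooth along L and provides both the
   normal field through a given normal vector, without cutoff functions, and the
   charts of X_mu.  The inverse function theorem is not needed: transition maps
   are differentiable because they are continuous and the charts are
   immersions. *)
Require Import Defs.
From mathcomp Require Import all_boot all_order all_algebra.
From mathcomp Require Import all_classical all_reals all_analysis.
From mathcomp Require Import complex ring lra.

Set Implicit Arguments.
Unset Strict Implicit.
Unset Printing Implicit Defensive.

Import Order.TTheory GRing.Theory Num.Theory.
Import numFieldNormedType.Exports.

Local Open Scope classical_set_scope.
Local Open Scope ring_scope.

(** * Differentials and Ck functions *)

Section LocalDifferential.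
Variables (R : realType) (V W : normedModType R).
Implicit Types (f g : V -> W).

Lemma diff_eps f x : differentiable f x -> forall eps, 0 < eps ->
  \forall y \near x, `|f y - f x - 'd f x (y - x)| <= eps * `|y - x|.
Proof.
move=> /diff_locally/eqaddoP fx eps e0; apply/nbhs0P.
have := fx eps e0; apply: filterS => h.
by rewrite !fctE /= opprD addrA (addrC x h) addrK.
Qed.

(** [diff_unique] identifies the differential first; differentiability follows, since
    [diff_locallyP] asks for the expansion with ['d f x] itself. *)
Lemma diff_epsP f x (A : {linear V -> W}) : continuous A ->
  (forall eps, 0 < eps ->
    \forall y \near x, `|f y - f x - A (y - x)| <= eps * `|y - x|) ->
  differentiable f x /\ 'd f x = A :> (V -> W).
Proof.
move=> Ac fA.
have E : f \o shift x = cst (f x) + A +o_ 0 id.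
  apply/eqaddoP => eps /fA /nbhs0P; apply: filterS => h.
  by rewrite !fctE /= (addrC x h) addrK opprD addrA.
have dE : 'd f x = A :> (V -> W) by exact: diff_unique.
by split=> //; apply/diff_locallyP; rewrite dE.
Qed.

Lemma near_eq_diff f g x : (\forall y \near x, f y = g y) ->
  differentiable f x -> differentiable g x /\ 'd g x = 'd f x :> (V -> W).
Proof.
move=> fg df; apply: diff_epsP; first exact: diff_continuous.
move=> eps /(diff_eps df); have fgx : f x = g x := nbhs_singleton fg.
by apply: filterS2 fg => y -> ; rewrite fgx.
Qed.

Lemma open_eq_diff (U : set V) f g x : open U -> U x ->
  (forall y, U y -> f y = g y) ->
  differentiable f x -> differentiable g x /\ 'd g x = 'd f x :> (V -> W).
Proof.
move=> oU Ux fg; apply: near_eq_diff.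
by apply: filterS (open_nbhs_nbhs (conj oU Ux)).
Qed.

End LocalDifferential.

(** * Closure properties of functions of class Ck on an open set *)

Section CkTheory.
Variables (R : realType) (V : normedModType R) (U : set V) (oU : open U).

(** The engine of the inductions below: the formula for the differential of a sum, product or
    inverse holds only on [U], so [Ck] has to be transported along equality on [U]. *)
Lemma Ck_eq k (W : normedModType R) (f g : V -> W) :
  (forall x, U x -> f x = g x) -> Ck k U f -> Ck k U g.
Proof.
elim: k f g => [|k IH] f g fg /=.
  move=> cf x Ux; have := cf x Ux; rewrite /prop_for /continuous_at -(fg x Ux).
  move=> h; apply: cvg_trans h; apply: near_eq_cvg.
  by apply: filterS (open_nbhs_nbhs (conj oU Ux)) => y /fg.
move=> [df Cf]; split=> [x Ux|v].
  exact: (open_eq_diff oU Ux fg (df x Ux)).1.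
apply: IH (Cf v) => x Ux.
exact: (esym (congr1 (fun h => h v) (open_eq_diff oU Ux fg (df x Ux)).2)).
Qed.

Lemma Ck_continuous k (W : normedModType R) (f : V -> W) x :
  Ck k U f -> U x -> {for x, continuous f}.
Proof.
case: k => [|k] /=; first exact.
by move=> [df _] Ux; exact/differentiable_continuous/df.
Qed.

Lemma CkW k (W : normedModType R) (f : V -> W) : Ck k.+1 U f -> Ck k U f.
Proof.
elim: k f => [|k IH] f Cf; first by move=> x; exact: Ck_continuous Cf.
by case: Cf => df Cf; split=> // v; exact/IH/Cf.
Qed.

Lemma Ck_cst k (W : normedModType R) (c : W) : Ck k U (fun=> c).
Proof.
elim: k c => [|k IH] c /=; first by move=> x _; exact: cst_continuous.
split=> [x _|v]; first exact: differentiable_cst.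
apply: Ck_eq (IH 0) => x _.
exact: (esym (congr1 (fun h => h v) (diff_cst c x))).
Qed.

Lemma CkD k (W : normedModType R) (f g : V -> W) :
  Ck k U f -> Ck k U g -> Ck k U (fun x => f x + g x).
Proof.
elim: k f g => [|k IH] f g /=.
  by move=> cf cg x Ux; apply: (@continuousD _ _ _ f g); [exact: cf|exact: cg].
move=> [df Cf] [dg Cg]; split=> [x Ux|v].
  by apply: differentiableD; [exact: df|exact: dg].
apply: Ck_eq (IH _ _ (Cf v) (Cg v)) => x Ux.
exact: (esym (congr1 (fun h => h v) (diffD (df x Ux) (dg x Ux)))).
Qed.

Lemma Ck_sum k (W : normedModType R) I (r : seq I) (P : pred I)
    (F : I -> V -> W) :
  (forall i, P i -> Ck k U (F i)) ->
  Ck k U (fun x => \sum_(i <- r | P i) F i x).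
Proof.
move=> CF; elim: r => [|i r IH].
  by apply: Ck_eq (Ck_cst k 0) => x _; rewrite big_nil.
have [Pi|nPi] := boolP (P i).
  by apply: Ck_eq (CkD (CF i Pi) IH) => x _; rewrite big_cons Pi.
by apply: Ck_eq IH => x _; rewrite big_cons (negPf nPi).
Qed.

Lemma CkM k (f g : V -> R) :
  Ck k U f -> Ck k U g -> Ck k U (fun x => f x * g x).
Proof.
elim: k f g => [|k IH] f g Cf Cg.
  move=> x Ux; apply: (@continuousM _ _ f g); [exact: Cf|exact: Cg].
have [df Df] := Cf; have [dg Dg] := Cg; split=> [x Ux|v].
  by apply: differentiableM; [exact: df|exact: dg].
apply: Ck_eq (CkD (IH _ _ (CkW Cf) (Dg v)) (IH _ _ (CkW Cg) (Df v))) => x Ux.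
exact: (esym (congr1 (fun h => h v) (diffM (df x Ux) (dg x Ux)))).
Qed.

Lemma Ck_prod k I (r : seq I) (F : I -> V -> R) :
  (forall i, Ck k U (F i)) -> Ck k U (fun x => \prod_(i <- r) F i x).
Proof.
move=> CF; elim: r => [|i r IH].
  by apply: (@Ck_eq k R (fun=> 1)) (Ck_cst k (1 : R)) => x _; rewrite big_nil.
by apply: (@Ck_eq k R) (CkM (CF i) IH) => x _; rewrite big_cons.
Qed.

Lemma CkV k (f : V -> R) : (forall x, U x -> f x != 0) ->
  Ck k U f -> Ck k U (fun x => (f x)^-1).
Proof.
move=> f0; elim: k => [|k IH] Cf.
  by move=> x Ux; apply: continuousV; [exact: f0|exact: Cf].
have [df Df] := Cf; split=> [x Ux|v].
  by apply: differentiableV; [exact: df|exact: f0].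
(* The differential of [1/f] is [- f^-2 df]: its first factor is of class [k] by induction, its
   second by hypothesis. *)
have CI := IH (CkW Cf).
have C := CkM (CkM (Ck_cst k (-1 : R)) (CkM CI CI)) (Df v).
apply: (@Ck_eq k R) C => x Ux.
rewrite [RHS](congr1 (fun h => h v) (diffV (df x Ux) (f0 x Ux))) /=.
by rewrite mulN1r expr2 invfM.
Qed.

Lemma CkZl k (W : normedModType R) (f : V -> R) (w : W) :
  Ck k U f -> Ck k U (fun x => f x *: w).
Proof.
elim: k f => [|k IH] f /=.
  by move=> cf x Ux; apply: cvgZr_tmp; exact: cf.
move=> [df Df]; split=> [x Ux|v]; first exact/differentiableZl/df.
apply: Ck_eq (IH _ (Df v)) => x Ux.
exact: (esym (congr1 (fun h => h v) (diffZl w (df x Ux)))).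
Qed.

Lemma Ck_linear k (W W' : normedModType R) (A : {linear W -> W'}) (f : V -> W) :
  continuous A -> Ck k U f -> Ck k U (A \o f).
Proof.
move=> Ac; elim: k f => [|k IH] f /=.
  by move=> cf x Ux; apply: continuous_comp; [exact: cf|exact: Ac].
move=> [df Df]; split=> [x Ux|v].
  by apply: differentiable_comp; [exact: df|exact: linear_differentiable].
apply: Ck_eq (IH _ (Df v)) => x Ux.
have := diff_comp (df x Ux) (linear_differentiable (f x) Ac).
by rewrite (diff_lin _ Ac) => /(congr1 (fun h => h v)).
Qed.

End CkTheory.

(** Differentiating [f \o A] along [v] gives the derivative of [f] along the fixed vector [A v],
    again precomposed with [A], so the induction closes without a chain rule for general Ck maps. *)
Lemma Ck_precomp_linear (R : realType) (V V' W : normedModType R) k (U : set V)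
    (A : {linear V' -> V}) (f : V -> W) :
  open U -> continuous A -> Ck k U f -> Ck k (A @^-1` U) (f \o A).
Proof.
move=> oU Ac; have oU' : open (A @^-1` U).
  by apply: open_comp => // x _; exact: Ac.
elim: k f => [|k IH] f /=.
  by move=> cf x Ux; apply: continuous_comp; [exact: Ac|exact: cf].
move=> [df Df]; split=> [x Ux|v].
  by apply: differentiable_comp; [exact: linear_differentiable|exact: df].
apply: (Ck_eq oU') (IH _ (Df (A v))) => x Ux /=.
have := diff_comp (linear_differentiable x Ac) (df _ Ux).
by rewrite (diff_lin _ Ac) => /(congr1 (fun h => h v)).
Qed.

Section CkMatrix.
Variables (R : realType) (V : normedModType R) (U : set V) (oU : open U).

Lemma linear_mx_continuous m n (W : normedModType R)
  (A : {linear 'M[R]_(m, n) -> W}) : continuous A.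
Proof.
move=> M.
have AE (N : 'M[R]_(m, n)) :
    A N = \sum_i \sum_j N i j *: A (delta_mx i j).
  rewrite {1}[N]matrix_sum_delta linear_sum; apply: eq_bigr => i _.
  by rewrite linear_sum; apply: eq_bigr => j _; rewrite linearZ.
rewrite (_ : (A : _ -> _) = fun N : 'M[R]_(m, n) =>
   \sum_i \sum_j N i j *: A (delta_mx i j)); last exact/funext/AE.
have op : open [set: 'M[R]_(m, n)] by exact: openT.
apply: (@Ck_continuous R _ setT 0) => //.
apply: Ck_sum => // i _; apply: Ck_sum => // j _; apply: CkZl => //.
by move=> x _; exact: coord_continuous.
Qed.

Lemma Ck_coord k m n (f : V -> 'M[R]_(m, n)) i j :
  Ck k U f -> Ck k U (fun x => f x i j : R).
Proof.
have @A : {linear 'M[R]_(m, n) -> R}.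
  by exists (fun N : 'M[R]_(_, _) => N i j); do 2![eexists]; do ?[constructor];
     rewrite ?mxE// => ? *; rewrite ?mxE//; move=> ?; rewrite !mxE.
exact: (@Ck_linear _ _ _ oU _ _ _ A f (@coord_continuous _ _ _ i j)).
Qed.

Lemma Ck_mx k m n (f : V -> 'M[R]_(m, n)) :
  (forall i j, Ck k U (fun x => f x i j : R)) -> Ck k U f.
Proof.
move=> Cf; apply: (@Ck_eq _ _ _ oU _ _
    (fun x => \sum_i \sum_j f x i j *: delta_mx i j)).
  by move=> x _; rewrite -matrix_sum_delta.
by apply: Ck_sum => // i _; apply: Ck_sum => // j _; apply: CkZl.
Qed.

Lemma Ck_mulmx k m n l (f : V -> 'M[R]_(m, n)) (g : V -> 'M[R]_(n, l)) :
  Ck k U f -> Ck k U g -> Ck k U (fun x => f x *m g x).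
Proof.
move=> Cf Cg; apply: Ck_mx => i j.
apply: (@Ck_eq _ _ _ oU _ _ (fun x => \sum_h f x i h * g x h j)).
  by move=> x _; rewrite mxE.
by apply: Ck_sum => // h _; apply: CkM => //; exact: Ck_coord.
Qed.

Lemma Ck_det k n (f : V -> 'M[R]_n) :
  Ck k U f -> Ck k U (fun x => \det (f x) : R).
Proof.
move=> Cf; apply: Ck_sum => // s _; apply: CkM => //; first exact: Ck_cst.
by apply: Ck_prod => // i; exact: Ck_coord.
Qed.

(** Cramer's rule: the entries of the inverse are cofactors divided by the determinant. *)
Lemma Ck_invmx k n (f : V -> 'M[R]_n) :
  (forall x, U x -> f x \in unitmx) ->
  Ck k U f -> Ck k U (fun x => invmx (f x)).
Proof.
move=> fU Cf; apply: Ck_mx => i j.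
apply: (@Ck_eq _ _ _ oU _ _
   (fun x => (\det (f x))^-1 *
             ((-1) ^+ (j + i) * \det (row' j (col' i (f x)))))).
  by move=> x Ux; rewrite /invmx fU // !mxE.
apply: CkM => //; first apply: CkV => //.
- by move=> x /fU; rewrite unitmxE unitfE.
- exact: Ck_det.
apply: CkM => //; first exact: Ck_cst.
apply: Ck_det; apply: Ck_mx => i' j'.
apply: (@Ck_eq _ _ _ oU _ _ (fun x => f x (lift j i') (lift i j'))).
  by move=> x _; rewrite !mxE.
exact: Ck_coord.
Qed.

End CkMatrix.

(** * Symmetry of the second differential *)

Section SecondDifferential.
Variables (R : realType) (V : normedModType R).

Lemma is_derive_line (f : V -> R) (c u : V) (s : R) :
  differentiable f (s *: u + c) ->
  is_derive s 1 (fun t : R => f (t *: u + c)) ('d f (s *: u + c) u).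
Proof.
move=> df.
have dl : is_diff s (fun t : R => t *: u + c) (fun t => t *: u).
  have -> : (fun t : R => t *: u + c) = ( *:%R^~ u : R -> V) + cst c by [].
  by apply: is_diff_eq; apply/funext => t; exact: addr0.
have df' : is_diff (s *: u + c) f ('d f (s *: u + c)) by exact: differentiableP.
have dfl : is_diff s (f \o (fun t : R => t *: u + c))
   ('d f (s *: u + c) \o (fun t => t *: u)) by exact: is_diff_comp.
apply: DeriveDef.
  by apply/derivable1_diffP; exact: (@ex_diff _ _ _ _ _ _ _ dfl).
rewrite deriveE; last exact: (@ex_diff _ _ _ _ _ _ _ dfl).
by rewrite (@diff_val _ _ _ _ _ _ _ dfl) /= scale1r.
Qed.

(** The mean value theorem on [[0, t]], applied to [s |-> f (s u + a + t v) - f (s u + a)], turns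
    the second difference into [t] times an increment of [b |-> 'd f b u], which is then expanded at
    [a]. *)
Lemma second_difference (f : V -> R) (a u v : V) :
  (\forall b \near a, differentiable f b) ->
  differentiable (fun b => 'd f b u) a ->
  forall eps, 0 < eps -> \forall t \near 0^'+,
    `|f (a + t *: u + t *: v) - f (a + t *: u) - f (a + t *: v) + f a
      - t ^+ 2 * 'd (fun b => 'd f b u) a v| <= eps * t ^+ 2.
Proof.
set F := fun b => 'd f b u => df dF eps e0.
(* Every point used lies within [t * K] of [a], and the summand 1 keeps [K] positive. Two expansions
   are made, each with error at most [eps / (2 * K)] times [t * K]. *)
pose K := `|u| + `|v| + 1.
have K0 : 0 < K by rewrite /K; have := normr_ge0 u; have := normr_ge0 v; lra.
have e'0 : 0 < eps / (2 * K) by rewrite divr_gt0 // mulr_gt0.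
have [d /= d0 H] := (nbhs_ballP _ _).1 (filterI df (diff_eps dF e'0)).
near=> t.
have t0 : 0 < t by near: t; exact: nbhs_right_gt.
have td : t * K < d.
  rewrite -ltr_pdivlMr //; near: t; apply: nbhs_right_lt; exact: divr_gt0.
have B s r : 0 <= s <= t -> 0 <= r <= t ->
    `|s *: u + r *: v| <= t * K /\ ball a d (s *: u + (a + r *: v)).
  move=> /andP[s0 st] /andP[r0 rt].
  have L : `|s *: u + r *: v| <= t * K.
    apply: (le_trans (ler_normD _ _)).
    rewrite !normrZ !ger0_norm // /K !mulrDr mulr1.
    have := ler_wpM2r (normr_ge0 u) st; have := ler_wpM2r (normr_ge0 v) rt; lra.
  split=> //; rewrite -ball_normE /ball_ /=.
  rewrite addrCA opprD addrA subrr sub0r normrN; exact: le_lt_trans L td.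
pose g s := f (s *: u + (a + t *: v)) - f (s *: u + a).
have tt : 0 <= t <= t by rewrite lexx ltW.
have O0 : (0 : R) <= 0 <= t by rewrite lexx ltW.
have D s r : 0 <= s <= t -> 0 <= r <= t ->
    differentiable f (s *: u + (a + r *: v)).
  by move=> sI rI; exact: (H _ (B s r sI rI).2).1.
have gd s : 0 <= s <= t ->
    is_derive s 1 g (F (s *: u + (a + t *: v)) - F (s *: u + a)).
  move=> sI; apply: is_deriveB; apply: is_derive_line; first exact: D.
  by have := D s 0 sI O0; rewrite scale0r addr0.
have [s||c cI gE] :=
  @MVT R g (fun s => F (s *: u + (a + t *: v)) - F (s *: u + a)) 0 t t0.
- by rewrite in_itv /= => /andP[s0 st]; apply: gd; rewrite !ltW.
- apply: derivable_within_continuous => s; rewrite in_itv /= => /gd.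
  by move=> ds; exact: (@ex_derive _ _ _ _ _ _ _ ds).
have cI' : 0 <= c <= t.
  by move: cI; rewrite in_itv /= => /andP[s0 st]; rewrite !ltW.
have -> : f (a + t *: u + t *: v) - f (a + t *: u) - f (a + t *: v) + f a =
    g t - g 0.
  rewrite /g scale0r !add0r addrA (addrC (t *: u) a); ring.
rewrite gE subr0.
have [L1 B1] := B c t cI' tt.
have [L0 B0] := B c 0 cI' O0; rewrite scale0r !addr0 in L0 B0.
have /= := (H _ B1).2; have /= := (H _ B0).2.
rewrite addrK (addrCA (c *: u) a) (addrC a (c *: u + t *: v)) addrK.
rewrite -/(F _) -/(F _).
have -> : 'd F a (c *: u + t *: v) = c * 'd F a u + t * 'd F a v.
  by rewrite linearD; congr (_ + _); exact: linearZ_LR.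
have -> : 'd F a (c *: u) = c * 'd F a u by exact: linearZ_LR.
move: (F (c *: u + a)) (F (c *: u + t *: v + a)) (F a) ('d F a u) ('d F a v).
move=> X0 X1 Fa Du Dv H0 H1.
(* Both values of [F] are compared with its expansion at [a]; the terms in [u] cancel and [t * Dv]
   is left. *)
have -> : (X1 - X0) * t - t ^+ 2 * Dv = t *
   ((X1 - Fa - (c * Du + t * Dv)) - (X0 - Fa - c * Du)).
  by ring.
rewrite normrM (gtr0_norm t0).
apply: (le_trans (ler_wpM2l (ltW t0) (ler_normB _ _))).
rewrite expr2 mulrCA; apply: ler_wpM2l; first exact: ltW.
apply: (le_trans (lerD H1 H0)); rewrite -mulrDr.
apply: (le_trans (ler_wpM2l (ltW e'0) (lerD L1 L0))).
have -> : eps / (2 * K) * (t * K + t * K) = t * eps.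
  by field; rewrite gt_eqF.
by rewrite mulrC.
Unshelve. all: by end_near. Qed.

(** The second difference is symmetric in [u] and [v], and [t ^+ 2] times either iterated
    differential approximates it. If these differed by [e > 0], two errors of [e / 4] would give
    [t ^+ 2 * e <= t ^+ 2 * e / 2]. *)
Lemma second_diff_sym (f : V -> R) (a u v : V) :
  (\forall b \near a, differentiable f b) ->
  differentiable (fun b => 'd f b u) a ->
  differentiable (fun b => 'd f b v) a ->
  'd (fun b => 'd f b u) a v = 'd (fun b => 'd f b v) a u.
Proof.
move=> df du dv; apply/eqP; rewrite -subr_eq0 -normr_le0 leNgt.
apply/negP => e0.
set X := 'd _ _ _ in e0; set Y := 'd _ _ _ in e0.
set e := `|X - Y| in e0.
have e40 : 0 < e / 4 by rewrite divr_gt0.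
have : \forall t \near (0 : R)^'+, False; last first.
  by move=> /(@filter_ex _ _ _)[].
near=> t.
have t0 : 0 < t by near: t; exact: nbhs_right_gt.
have H1 : `|f (a + t *: u + t *: v) - f (a + t *: u) - f (a + t *: v) + f a
      - t ^+ 2 * X| <= e / 4 * t ^+ 2.
  by near: t; exact: second_difference.
have H2 : `|f (a + t *: v + t *: u) - f (a + t *: v) - f (a + t *: u) + f a
      - t ^+ 2 * Y| <= e / 4 * t ^+ 2.
  by near: t; exact: second_difference.
rewrite -(addrA a (t *: v)) (addrC (t *: v)) addrA in H2.
have := le_trans (ler_normB _ _) (lerD H2 H1).
set A := f _; set B := f _; set C := f _.
have -> : A - B - C + f a - t ^+ 2 * Y - (A - C - B + f a - t ^+ 2 * X)
  = t ^+ 2 * (X - Y) by ring.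
rewrite normrM -/e ger0_norm ?sqr_ge0 // => H.
have : 0 < t ^+ 2 * e by rewrite mulr_gt0 // exprn_gt0.
lra.
Unshelve. all: by end_near. Qed.

End SecondDifferential.

(** * Lifting differentiability through an immersion *)

Section Lift.
Variables (R : realType) (V : normedModType R).

Lemma diff_coord m n (f : V -> 'M[R]_(m, n)) x v i j : differentiable f x ->
  differentiable (fun y => f y i j : R) x /\
  'd (fun y => f y i j : R) x v = ('d f x v) i j.
Proof.
move=> df.
have @A : {linear 'M[R]_(m, n) -> R}.
  by exists (fun N : 'M[R]_(_, _) => N i j); do 2![eexists]; do ?[constructor];
     rewrite ?mxE// => ? *; rewrite ?mxE//; move=> ?; rewrite !mxE.
have Ac : continuous A by exact: coord_continuous.
have dA : differentiable A (f x) by exact: linear_differentiable.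
split; first exact: (differentiable_comp df dA).
by have := diff_comp df dA; rewrite diff_lin // => /(congr1 (fun h => h v)).
Qed.

Lemma linear_injective_row_free m n (A : {linear 'rV[R]_m -> 'rV[R]_n}) :
  injective A -> row_free (lin1_mx A).
Proof.
move=> Ai; rewrite -kermx_eq0; apply/eqP/row_matrixP => i.
have /(congr1 (row i)) := mulmx_ker (lin1_mx A).
rewrite row_mul row0 mul_rV_lin1 => h.
by rewrite row0; apply: Ai; rewrite h linear0.
Qed.

(* A left inverse of the injective differential of g turns g o c = k into an
   equation for c up to an error small with respect to c b - c a, which is then
   O(b - a). *)
Lemma diff_lift p m (c : V -> 'rV[R]_p) (g : 'rV[R]_p -> 'rV[R]_m)
    (k : V -> 'rV[R]_m) (a : V) :
  {for a, continuous c} -> (\forall b \near a, k b = g (c b)) ->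
  differentiable k a -> differentiable g (c a) -> injective ('d g (c a)) ->
  differentiable c a.
Proof.
move=> cc kg dk dg dgi.
have /row_freeP[B JB] := linear_injective_row_free dgi.
pose A : {linear V -> 'rV[R]_p} := mulmxr B \o 'd k a.
have Bc : continuous (mulmxr B : {linear 'rV[R]_m -> 'rV[R]_p}).
  exact: linear_mx_continuous.
have Ac : continuous A.
  move=> x; apply: continuous_comp; last exact: Bc.
  exact: diff_continuous.
have [be be0 Hbe] := linear_lipschitz Bc;
  have [al al0 Hal] := linear_lipschitz Ac.
have key e : 0 < e -> \forall b \near a,
    `|c b - c a - A (b - a)| <= be * e * (`|c b - c a| + `|b - a|).
  move=> e0; have Hg := diff_eps dg e0; have Hk := diff_eps dk e0.
  have Hb : \forall b \near a, `|g (c b) - g (c a) - 'd g (c a) (c b - c a)| <=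
      e * `|c b - c a| by exact: cc Hg.
  near=> b.
  have kE : k b = g (c b) by near: b.
  have -> : c b - c a - A (b - a) =
     mulmxr B (k b - k a - 'd k a (b - a))
     - mulmxr B (g (c b) - g (c a) - 'd g (c a) (c b - c a)).
    have dB x : 'd g (c a) x *m B = x by rewrite -mul_rV_lin1 -mulmxA JB mulmx1.
    rewrite -kE -(nbhs_singleton kg) /A /= !mulmxBl dB opprB.
    by rewrite [RHS]addrC subrKA.
  apply: (le_trans (ler_normB _ _)); rewrite -mulrA !mulrDr addrC.
  apply: lerD; apply: (le_trans (Hbe _)); (apply: ler_wpM2l; first exact: ltW).
    by near: b; exact: Hb.
  by near: b; exact: Hk.
have lip : \forall b \near a, `|c b - c a| <= (2 * al + 1) * `|b - a|.
  (* This choice makes the coefficient [be * e] equal to 1/2, so that half of [|c b - c a|] is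
     absorbed by the left side. *)
  have e0 : 0 < (2 * be)^-1 by rewrite invr_gt0 mulr_gt0.
  apply: filterS (key _ e0) => b.
  have -> : be * (2 * be)^-1 = 2^-1 by field; rewrite gt_eqF.
  have := Hal (b - a); have := ler_normD (c b - c a - A (b - a)) (A (b - a)).
  rewrite subrK; lra.
suff /(diff_epsP Ac)[] : forall e, 0 < e ->
  \forall b \near a, `|c b - c a - A (b - a)| <= e * `|b - a| by [].
move=> e e0.
(* By [lip], the sum [|c b - c a| + |b - a|] is at most [(2 * al + 2) * |b - a|]. *)
have e1 : 0 < e / (be * (2 * al + 2)).
  by rewrite divr_gt0 // mulr_gt0 // addr_gt0 // mulr_gt0.
apply: filterS2 (key _ e1) lip => b H L; apply: (le_trans H).
have -> : be * (e / (be * (2 * al + 2))) = e / (2 * al + 2).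
  by field; rewrite !gt_eqF // addr_gt0 // mulr_gt0.
rewrite -mulrA; apply: ler_wpM2l; first exact: ltW.
rewrite mulrC ler_pdivrMr; last by rewrite addr_gt0 // mulr_gt0.
by rewrite mulrC; lra.
Unshelve. all: by end_near. Qed.

End Lift.

(** * Determinants and the polynomials sigma *)

(** Sylvester's identity: the two sides are the determinants of two factorizations of one block
    matrix into block triangular ones. *)
Lemma det_1D_mulmx (K : comNzRingType) m n
    (A : 'M[K]_(m, n)) (B : 'M[K]_(n, m)) :
  \det (1%:M + A *m B) = \det (1%:M + B *m A).
Proof.
have E : block_mx 1%:M 0 B 1%:M *m block_mx 1%:M (- A) 0 (1%:M + B *m A) =
  block_mx (1%:M + A *m B) (- A) 0 1%:M *m block_mx 1%:M 0 B 1%:M.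
  rewrite !mulmx_block !mulmx1 !mul1mx !mulmx0 !mul0mx !addr0 !add0r.
  rewrite mulmxN mulNmx.
  by rewrite (addrC (- (B *m A))) !addrK.
have := congr1 determinant E.
by rewrite !det_mulmx !det_lblock !det_ublock !det1 !mul1r !mulr1 => ->.
Qed.

(** Once ['i] is factored out, what remains is the identity plus a matrix factoring through
    dimension [p], so Sylvester's identity reduces the size from [n] to [p]. There [-'i] comes out,
    and its [p]-th power cancels [p] of the [n] factors ['i]. *)
Lemma det_twisted (R : realType) n p (hpn : (p <= n)%N)
    (E : 'M[R[i]]_(p, n)) (Et : 'M[R[i]]_(n, p)) (S : 'M[R[i]]_p) :
  E *m Et = 1%:M ->
  \det (Et *m E + 'i%C *: (Et *m S *m E + (1%:M - Et *m E))) =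
  'i%C ^+ (n - p) * \det (1%:M + 'i%C *: S).
Proof.
move=> EEt; set I := 'i%C; have I2 : I * I = -1 by rewrite -expr2 sqr_i.
pose K := (- I)%:M + S - 1%:M.
have -> : Et *m E + I *: (Et *m S *m E + (1%:M - Et *m E)) =
    I *: (1%:M + Et *m (K *m E)).
  rewrite !mulmxBl !mulmxDl mul1mx mul_scalar_mx mulmxBr mulmxDr -scalemxAr.
  rewrite mulmxA.
  rewrite !scalerDr !scalerN scalerA mulrN I2 opprK scale1r.
  move: (Et *m E) (Et *m S *m E) => X Y.
  by apply/matrixP => i j; rewrite !mxE; ring.
rewrite detZ det_1D_mulmx -mulmxA EEt mulmx1 addrC subrK.
have -> : (- I)%:M + S = (- I) *: (1%:M + I *: S).
  by rewrite scalerDr scalerA mulNr I2 opprK scale1r scalemx1.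
have -> : I ^+ n = I ^+ (n - p) * I ^+ p by rewrite -exprD subnK.
rewrite detZ mulrA -[_ * (- I) ^+ p]mulrA -exprMn mulrN I2 opprK.
by rewrite expr1n mulr1.
Qed.

(** The naturals below [size P] are distinct roots, one more than the degree allows. *)
Lemma poly_eq0_horner (R : numDomainType) (P : {poly R}) :
  (forall t, P.[t] = 0) -> P = 0.
Proof.
move=> P0; apply: (@roots_geq_poly_eq0 _ _ [seq i%:R | i <- iota 0 (size P)]).
- by apply/allP => t _; rewrite /root P0.
- by rewrite map_inj_uniq ?iota_uniq // => i j /eqP; rewrite eqr_nat => /eqP.
- by rewrite size_map size_iota.
Qed.

Lemma det_sigma (K : comNzRingType) p (C : 'M[K]_p) x :
  \det (1%:M + x *: C) = \sum_(j < p.+1) sigma j C * x ^+ j.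
Proof.
set Q := \det (1%:M + 'X *: map_mx polyC C).
have sQ : (size Q <= p.+1)%N.
  apply: (leq_trans (size_sum _ _ _)); apply/bigmax_leqP => s _.
  (* A product of [p] polynomials has size at most the sum of their sizes plus [1 - p]; each entry
     has size at most 2, whence [p.+1]. *)
  rewrite size_Msign.
  apply: (leq_trans (size_poly_prod_leq _ _)).
  rewrite -/(#|'I_p|) card_ord leq_subLR addnS ltnS.
  have -> : (p + p = \sum_(i < p) 2)%N.
    by rewrite sum_nat_const card_ord muln2 addnn.
  apply: leq_sum => i _; rewrite !mxE; apply: (leq_trans (size_polyD _ _)).
  rewrite geq_max -polyC_natr (leq_trans (size_polyC_leq1 _)) //=.
  rewrite mulrC; apply: (leq_trans (size_polyMleq _ _)).
  by rewrite size_polyX addn2 ltnS size_polyC_leq1.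
have -> : \det (1%:M + x *: C) = Q.[x].
  rewrite -horner_evalE -det_map_mx; congr (\det _); apply/matrixP => i j.
  rewrite !mxE /= horner_evalE hornerD hornerM hornerX hornerC.
  by rewrite -polyC_natr hornerC.
by rewrite (horner_coef_wide _ sQ).
Qed.

Lemma sigma_map (K K' : comNzRingType) (f : {rmorphism K -> K'}) p j
    (C : 'M[K]_p) :
  sigma j (map_mx f C) = f (sigma j C).
Proof.
rewrite /sigma -coef_map -det_map_mx; congr (polyseq _)`_j; congr (\det _).
apply/matrixP => i k; rewrite !mxE rmorphD rmorphM /= map_polyX map_polyC /=.
by rewrite rmorph_nat.
Qed.

Lemma sigma0 (K : comNzRingType) p (C : 'M[K]_p) : sigma 0 C = 1.
Proof.
rewrite /sigma -horner_coef0 -horner_evalE -det_map_mx -[RHS](det1 K p).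
congr (\det _); apply/matrixP => i j.
rewrite !mxE /= horner_evalE hornerD hornerM hornerX mul0r addr0.
by rewrite -polyC_natr hornerC.
Qed.

Lemma Im_eq0 (R : rcfType) (z : R[i]) : complex.Im z = 0 <-> conjc z = z.
Proof.
case: z => a b; split=> [/= -> /=|[] /=]; first by rewrite oppr0.
by move/eqP; rewrite -subr_eq0 -opprD oppr_eq0 -mulr2n mulrn_eq0 => /eqP.
Qed.

Lemma conjci (R : rcfType) : conjc 'i%C = - 'i%C :> R[i].
Proof. by apply/eqP; rewrite eq_complex /= oppr0 !eqxx. Qed.

(** The product of [1 + iB] and [1 - iB] is the real matrix [1 + B^2], which is positive definite:
    [v (1 + B^2) v^T] is the sum of the squared norms of [v] and [v B]. *)
Lemma unitmx_1D_imaginary (R : realType) p (B : 'M[R]_p) : B^T = B ->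
  1%:M + 'i%C *: toC B \in unitmx.
Proof.
move=> BT.
suff : (1%:M + 'i%C *: toC B) *m (1%:M - 'i%C *: toC B) \in unitmx.
  by rewrite unitmx_mul => /andP[].
have -> : (1%:M + 'i%C *: toC B) *m (1%:M - 'i%C *: toC B) =
    toC (1%:M + B *m B).
  rewrite /toC map_mxD map_mx1 map_mxM mulmxDl mul1mx mulmxBr mulmx1.
  rewrite -scalemxAl -scalemxAr scalerA -expr2 sqr_i scaleN1r opprK.
  by rewrite addrA subrK.
rewrite map_unitmx -row_free_unit -kermx_eq0.
apply/eqP/row_matrixP => i; rewrite row0.
have := congr1 (row i) (mulmx_ker (1%:M + B *m B)).
rewrite row_mul row0; set v := row i _ => v0.
have : v *m v^T + (v *m B) *m (v *m B)^T = 0.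
  have := congr1 (mulmx^~ v^T) v0.
  by rewrite /= mulmxDr mulmx1 mulmxDl mul0mx trmx_mul BT !mulmxA.
move=> /matrixP/(_ 0 0); rewrite !mxE.
have sq (w : 'rV[R]_p) k : w 0 k * w^T k 0 = w 0 k ^+ 2 by rewrite mxE expr2.
under eq_bigr do rewrite sq; under [X in _ + X]eq_bigr do rewrite sq.
have s0 (w : 'rV[R]_p) : 0 <= \sum_k w 0 k ^+ 2.
  by apply: sumr_ge0 => k _; exact: sqr_ge0.
move/eqP; rewrite paddr_eq0 // => /andP[/eqP/psumr_eq0P vk _].
apply/rowP => k; rewrite [RHS]mxE; apply/eqP; rewrite -sqrf_eq0.
by apply/eqP/vk => // l _; exact: sqr_ge0.
Qed.

Lemma toC_linear (R : realType) m n (t : R) (A B : 'M[R]_(m, n)) :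
  map_mx (real_complex R) (t *: A + B) =
  t%:C%C *: map_mx (real_complex R) A + map_mx (real_complex R) B.
Proof. by rewrite map_mxD map_mxZ. Qed.

(** With [G = 1 + iB], the factorization [1 + i(tA + B) = (1 + it A G^-1) G] exhibits the left side
    as a real polynomial in [t]. Its constant coefficient makes [k = c det G] real; then
    conjugation, which exchanges [1 + iB] and [1 - iB], translates the vanishing of the others. *)
Lemma Im_det_sigma (R : realType) p (A B : 'M[R]_p) (c : R[i]) :
  c != 0 -> B^T = B ->
  (forall t : R,
     complex.Im (c * \det (1%:M + 'i%C *: toC (t *: A + B))) = 0) <->
  complex.Im (c * \det (1%:M + 'i%C *: toC B)) = 0 /\
  (forall j : nat, (1 <= j <= p)%N ->
     sigma j (toC A *m invmx (1%:M + 'i%C *: toC B)) =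
     (-1) ^+ j * sigma j (toC A *m invmx (1%:M - 'i%C *: toC B))).
Proof.
move=> c0 BT; have Gu := unitmx_1D_imaginary BT.
have [G GE] : exists G, G = 1%:M + 'i%C *: toC B by eexists.
rewrite -GE in Gu *.
set C := toC A *m invmx G; have [k kdef] : exists k, k = c * \det G by eexists.
rewrite -kdef.
have k0 : k != 0 by rewrite kdef mulf_neq0 // -unitfE -unitmxE.
have conjC : map_mx conjc C = toC A *m invmx (1%:M - 'i%C *: toC B).
  have toCJ (M : 'M[R]_p) : map_mx conjc (toC M) = toC M.
    by apply/matrixP => i j; rewrite !mxE conjc_real.
  rewrite map_mxM map_invmx toCJ GE map_mxD map_mx1 map_mxZ toCJ.
  by congr (_ *m invmx (_ + _)); rewrite -scaleNr; congr (_ *: _);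
    exact: conjci.
pose a j := k * sigma j C * 'i%C ^+ j.
have conjM (x y : R[i]) : conjc (x * y) = conjc x * conjc y by exact: rmorphM.
have conjX (x : R[i]) n : conjc (x ^+ n) = conjc x ^+ n by exact: rmorphXn.
have ImD (x y : R[i]) : complex.Im (x + y) = complex.Im x + complex.Im y.
  by case: x; case: y.
have ImM (x : R[i]) (y : R) : complex.Im (x * y%:C%C) = complex.Im x * y.
  by case: x => x1 x2 /=; rewrite mulr0 add0r.
have kE X : c * \det (X *m G) = k * \det X.
  by rewrite kdef det_mulmx mulrA mulrAC.
have detE t : complex.Im (c * \det (1%:M + 'i%C *: toC (t *: A + B))) =
    (\poly_(j < p.+1) complex.Im (a j)).[t].
  have -> : 1%:M + 'i%C *: toC (t *: A + B) =
      (1%:M + ('i%C * t%:C%C) *: C) *m G.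
    have CG : C *m G = toC A by exact: mulmxKV.
    rewrite mulmxDl mul1mx -scalemxAl CG; rewrite /toC toC_linear.
    rewrite GE scalerDr scalerA -addrA.
    exact: (congr1 (+%R 1%:M) (addrC _ _)).
  rewrite kE det_sigma mulr_sumr horner_poly.
  rewrite (big_morph _ ImD (erefl : complex.Im 0 = 0)).
  apply: eq_bigr => j _; rewrite exprMn -rmorphXn /= !mulrA ImM.
  by rewrite /a.
have aE j : (complex.Im k = 0) -> complex.Im (a j) = 0 <->
     sigma j C = (-1) ^+ j * sigma j (toC A *m invmx (1%:M - 'i%C *: toC B)).
  move=> /Im_eq0 kk; rewrite Im_eq0 /a !conjM conjX kk -conjC sigma_map /=.
  have -> : conjc 'i%C ^+ j = (-1) ^+ j * 'i%C ^+ j :> R[i].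
    by rewrite conjci; exact: exprNn.
  have ij0 : ('i%C : R[i]) ^+ j != 0.
    by rewrite expf_neq0 // eq_complex /= oner_eq0 andbF.
  move: (sigma j C) (conjc (sigma j C)) => s s'.
  rewrite mulrA; split=> [/(mulIf ij0)|->]; last by ring.
  by rewrite -mulrA => /(mulfI k0) <-; rewrite mulrC.
split=> [H|[H0 H] t]; last first.
  rewrite detE horner_poly big1 // => -[j /= jp] _.
  suff -> : complex.Im (a j) = 0 by rewrite mul0r.
  case: j jp => [|j] jp; first by rewrite /a sigma0 !mulr1.
  by apply/aE => //; apply: H; rewrite -ltnS.
have P0 : \poly_(j < p.+1) complex.Im (a j) = 0.
  by apply: poly_eq0_horner => t; rewrite -detE.
have a0 j : (j <= p)%N -> complex.Im (a j) = 0.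
  by move=> jp; have := congr1 (fun q : {poly R} => q`_j) P0;
    rewrite coef_poly ltnS jp coef0.
have Ik : complex.Im k = 0 by have := a0 0 isT; rewrite /a sigma0 !mulr1.
by split=> // j /andP[_ /a0/aE]; apply.
Qed.

(** * Charts and tangent spaces *)

Lemma near_diff_comp (R : realType) (V V' W : normedModType R) (t : V -> V')
    (g : V' -> W) (f : V -> W) a b u :
  t a = b -> differentiable t a -> differentiable g b ->
  (\forall y \near a, f y = g (t y)) -> 'd f a u = 'd g b ('d t a u).
Proof.
move=> <- dt dg fgt.
have gtf : \forall y \near a, (g \o t) y = f y by apply: filterS fgt => y ->.
have [_ h] := near_eq_diff gtf (differentiable_comp dt dg).
exact: etrans (congr1 (fun k => k u) h)
              (congr1 (fun k => k u) (diff_comp dt dg)).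
Qed.

Section Charts.
Variables (R : realType) (p m : nat) (L : set 'rV[R]_m).
Implicit Types (V : set 'rV[R]_p) (phi psi : 'rV[R]_p -> 'rV[R]_m).

Lemma parametrization_differentiable V phi a :
  parametrization L V phi -> V a -> differentiable phi a.
Proof. by move=> H Va; have [dphi _] := param_smooth H 1%N; exact: dphi. Qed.

Lemma parametrization_sub V phi a : parametrization L V phi -> V a -> L (phi a).
Proof.
move=> H Va.
have [U _ /seteqP[sub _]] := param_openmap H (param_open H) (@subset_refl _ V).
by have [] : (L `&` U) (phi a) by apply: sub; exists a.
Qed.

(** Here [tau] is [psi^-1 \o phi]. It is continuous at [a] because [psi] is open onto [L], and
    [diff_lift] upgrades this to differentiability because [psi] is an immersion. *)
Lemma transition V phi a V' psi b :
  parametrization L V phi -> V a -> parametrization L V' psi -> V' b ->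
  phi a = psi b ->
  exists tau, [/\ tau a = b, differentiable tau a &
                  \forall y \near a, phi y = psi (tau y)].
Proof.
move=> Hphi Va Hpsi V'b ab.
pose tau y := get [set z | V' z /\ psi z = phi y].
have tauE y z : V' z -> psi z = phi y -> tau y = z.
  move=> V'z zy; apply: get_unique => // z' [V'z' z'y].
  by apply: (param_inj Hpsi); rewrite ?inE // z'y.
have tauab : tau a = b by exact: tauE.
(* Shrink [A] to an open subset of [V']; its image under [psi] is the trace on [L] of an open set,
   which [phi] enters near [a]. This yields both continuity of [tau] and the factorization of
   [phi]. *)
have local (A : set 'rV[R]_p) : nbhs b A ->
    \forall y \near a, A (tau y) /\ phi y = psi (tau y).
  move=> bA; have : nbhs b (A `&` V').
    by apply: filterI => //; exact: open_nbhs_nbhs (conj (param_open Hpsi) V'b).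
  rewrite nbhsE /= => -[W [oW Wb] WA].
  have [|U oU UE] := param_openmap Hpsi oW; first by move=> z /WA[].
  have Ub : U (phi a).
    by rewrite ab; have [] : (L `&` U) (psi b) by rewrite -UE; exists b.
  have cphi : {for a, continuous phi}.
    exact/differentiable_continuous/(parametrization_differentiable Hphi Va).
  have HU : \forall y \near a, U (phi y).
    exact: cphi (open_nbhs_nbhs (conj oU Ub)).
  have HV := open_nbhs_nbhs (conj (param_open Hphi) Va).
  apply: filterS (filterI HU HV) => y [/= Uy Vy].
  have : (L `&` U) (phi y) by split => //; exact: parametrization_sub Hphi Vy.
  by rewrite -UE => -[z Wz zy]; have [Az V'z] := WA _ Wz;
    rewrite (tauE _ _ V'z zy).
have ev : \forall y \near a, phi y = psi (tau y).
  by apply: filterS (local setT filterT) => y [].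
exists tau; split => //.
apply: (@diff_lift _ _ _ _ tau psi phi) => //; rewrite ?tauab.
- by move=> A /=; rewrite tauab => /local; apply: filterS => y [].
- exact: parametrization_differentiable Hphi Va.
- exact: parametrization_differentiable Hpsi V'b.
- exact: param_immersion Hpsi _ V'b.
Qed.

(** Independence of the chart, which makes [nabla] well defined: injectivity of ['d psi b] forces
    the transition map to send [u] to [u']. *)
Lemma transition_diff (W : normedModType R) (f : 'rV[R]_m -> W)
    V phi a V' psi b :
  parametrization L V phi -> V a -> parametrization L V' psi -> V' b ->
  phi a = psi b -> differentiable (f \o psi) b ->
  forall u u', 'd phi a u = 'd psi b u' ->
  'd (f \o phi) a u = 'd (f \o psi) b u'.
Proof.
move=> Hphi Va Hpsi V'b ab df u u' uu'.
have [tau [tauab dtau near_tau]] := transition Hphi Va Hpsi V'b ab.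
have dpsi := parametrization_differentiable Hpsi V'b.
have E1 := near_diff_comp u tauab dtau dpsi near_tau.
have E2 := param_immersion Hpsi V'b (etrans (esym E1) uu').
have near_f : \forall y \near a, (f \o phi) y = (f \o psi) (tau y).
  by apply: filterS near_tau => y /= ->.
by rewrite -E2; exact: near_diff_comp u tauab dtau df near_f.
Qed.

(** Reduces the existential over all charts to the chart at hand, so that the tangent space is the
    range of one linear map. *)
Lemma tangentP V phi a w : parametrization L V phi -> V a ->
  tangent p L (phi a) w <-> exists u, 'd phi a u = w.
Proof.
move=> Hphi Va.
split=> [[V' [psi [b [u [Hpsi V'b ba <-]]]]]|[u uw]];
  last by exists V, phi, a, u.
have [tau [tauab dtau near_tau]] := transition Hpsi V'b Hphi Va ba.
exists ('d tau b u); apply/esym.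
by apply: near_diff_comp => //; exact: parametrization_differentiable Hphi Va.
Qed.

Lemma nablaE f V phi a u : smooth_along p L f ->
  parametrization L V phi -> V a ->
  nabla p L f (phi a) ('d phi a u) = 'd (f \o phi) a u.
Proof.
move=> sf Hphi Va; apply: get_unique; first by exists V, phi, a, u.
move=> _ [V' [psi [b [u' [Hpsi V'b ba uu' <-]]]]].
have [df _] := sf _ _ Hphi 1%N.
exact: (transition_diff Hpsi V'b Hphi Va ba (df _ Va)).
Qed.

End Charts.

(** * Orthonormal frames and orthogonal projections *)

Section Frames.
Variables (R : realType) (p m : nat) (L : set 'rV[R]_m).
Hypothesis hL : submanifold p L.
Implicit Types (V : set 'rV[R]_p) (phi : 'rV[R]_p -> 'rV[R]_m).
Variables (e : 'rV[R]_m -> 'M[R]_(p, m)) (he : orthonormal_frame L e).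

Lemma dotE n (u v : 'rV[R]_n) : dot u v = (u *m v^T) 0 0.
Proof. by rewrite mxE; apply: eq_bigr => k _; rewrite !mxE. Qed.

Lemma dot_row k l n (A : 'M[R]_(k, n)) (B : 'M[R]_(l, n)) i j :
  dot (row i A) (row j B) = (A *m B^T) i j.
Proof. by rewrite mxE; apply: eq_bigr => h _; rewrite !mxE. Qed.

Lemma frame_mulT x : L x -> e x *m (e x)^T = 1%:M.
Proof.
move=> Lx; apply/matrixP => i j; rewrite -dot_row (he Lx).2.
by rewrite !mxE.
Qed.

(** One inclusion holds because the frame is tangent; equality follows by rank, as the [p]
    orthonormal rows are independent and the Jacobian has only [p] rows. *)
Lemma frame_jacobian V phi a : parametrization L V phi -> V a ->
  (e (phi a) :=: lin1_mx ('d phi a))%MS.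
Proof.
move=> Hphi Va; have Lx := parametrization_sub Hphi Va.
have sEJ : (e (phi a) <= lin1_mx ('d phi a))%MS.
  apply/row_subP => i; have [u <-] := (tangentP _ Hphi Va).1 ((he Lx).1 i).
  by rewrite -mul_rV_lin1 submxMl.
apply/eqmxP; rewrite -(geq_leqif (mxrank_leqif_eq sEJ)).
have : row_free (e (phi a)).
  by apply/row_freeP; exists (e (phi a))^T; exact: frame_mulT.
by rewrite /row_free => /eqP ->; exact: rank_leq_row.
Qed.

Lemma tangent_frameP x w : L x ->
  tangent p L x w <-> w *m (e x)^T *m e x = w.
Proof.
move=> Lx; have [V [phi [a [Hphi Va ax]]]] := hL Lx; rewrite -ax in Lx *.
rewrite (tangentP _ Hphi Va); split=> [[u <-]|<-].
  have /submxP[c ->] : ('d phi a u <= e (phi a))%MS.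
    by rewrite (frame_jacobian Hphi Va) -mul_rV_lin1 submxMl.
  by rewrite -(mulmxA c) frame_mulT // mulmx1.
have /submxP[c ->] : (w *m (e (phi a))^T *m e (phi a) <= lin1_mx ('d phi a))%MS.
  by rewrite -(frame_jacobian Hphi Va) submxMl.
by exists c; rewrite mul_rV_lin1.
Qed.

Lemma normal_frameP x nu : L x ->
  normal_at p L x nu <-> nu *m (e x)^T = 0.
Proof.
move=> Lx; split=> [H|H w /tangent_frameP - /(_ Lx) <-].
  apply/rowP => j; rewrite [RHS]mxE -(H _ ((he Lx).1 j)) mxE.
  by apply: eq_bigr => k _; rewrite !mxE.
by rewrite dotE trmx_mul mulmxA H mul0mx mxE.
Qed.

(** The frame may vary wildly with the point, but the orthogonal projection that it defines does
    not: written through the Jacobian and its Gram matrix, it is visibly smooth. *)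
Lemma frame_projE V phi a (J := lin1_mx ('d phi a)) :
  parametrization L V phi -> V a ->
  J *m J^T \in unitmx /\
  (e (phi a))^T *m e (phi a) = J^T *m invmx (J *m J^T) *m J.
Proof.
move=> Hphi Va; have Lx := parametrization_sub Hphi Va.
have EE := frame_mulT Lx; have EJ := frame_jacobian Hphi Va.
have /submxP[C EC] : (e (phi a) <= J)%MS by rewrite EJ.
have /submxP[D JD] : (J <= e (phi a))%MS by rewrite EJ.
have CD : C *m D = 1%:M.
  have CDE : C *m D *m e (phi a) = e (phi a) by rewrite -mulmxA -JD -EC.
  by rewrite -[LHS]mulmx1 -EE mulmxA CDE.
have [_ Du] := mulmx1_unit CD.
have JJ : J *m J^T = D *m D^T.
  by rewrite {1 2}JD trmx_mul mulmxA -(mulmxA D) EE mulmx1.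
have Dtu : D^T \in unitmx by rewrite unitmx_tr.
have Xu : J *m J^T \in unitmx by rewrite JJ unitmx_mul Du.
split=> //; suff Y : D^T *m invmx (J *m J^T) *m D = 1%:M.
  by rewrite {1 4}JD trmx_mul !mulmxA -2!(mulmxA _^T) Y mulmx1.
by rewrite -[LHS](mulKmx Du) 2!(mulmxA D) -JJ mulmxV // mul1mx mulVmx.
Qed.

End Frames.

(** * The second fundamental form *)

Section DiffDot.
Variables (R : realType) (V : normedModType R).

Lemma diff_sum I (r : seq I) (F : I -> V -> R) a u :
  (forall i, differentiable (F i) a) ->
  differentiable (fun y => \sum_(i <- r) F i y) a /\
  'd (fun y => \sum_(i <- r) F i y) a u = \sum_(i <- r) 'd (F i) a u.
Proof.
move=> dF; elim: r => [|i r [dr rE]].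
  have -> : (fun y => \sum_(i <- [::]) F i y) = cst 0.
    by apply/funext => y; rewrite big_nil.
  split; first exact: differentiable_cst.
  by rewrite big_nil; exact: (congr1 (fun h => h u) (diff_cst _ _)).
have -> : (fun y => \sum_(j <- i :: r) F j y) =
    F i + (fun y => \sum_(j <- r) F j y).
  by apply/funext => y; rewrite big_cons.
split; first exact: differentiableD.
rewrite big_cons -rE; exact: (congr1 (fun h => h u) (diffD (dF i) dr)).
Qed.

Lemma diff_dot n (f g : V -> 'rV[R]_n) a u :
  differentiable f a -> differentiable g a ->
  differentiable (fun y => dot (f y) (g y)) a /\
  'd (fun y => dot (f y) (g y)) a u =
    dot ('d f a u) (g a) + dot (f a) ('d g a u).
Proof.
move=> df dg.
have dfk k := diff_coord u 0 k df; have dgk k := diff_coord u 0 k dg.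
pose F k := (fun y => f y 0 k : R) * (fun y => g y 0 k : R).
have dF k : differentiable (F k) a.
  by apply: differentiableM; [exact: (dfk k).1|exact: (dgk k).1].
have [dS dSE] := diff_sum (index_enum 'I_n) u dF.
split; first exact: dS.
rewrite [LHS]dSE /dot -big_split /=; apply: eq_bigr => k _.
rewrite [LHS](congr1 (fun h => h u) (diffM (dfk k).1 (dgk k).1)) /=.
rewrite [LHS]addrC; apply: f_equal2.
  rewrite [RHS]mulrC.
  exact: (f_equal2 (@GRing.mul R) (erefl (g a 0 k)) (dfk k).2).
exact: (f_equal2 (@GRing.mul R) (erefl (f a 0 k)) (dgk k).2).
Qed.

End DiffDot.

Section SecondFundamentalForm.
Variables (R : realType) (p m : nat) (L : set 'rV[R]_m).
Hypothesis hL : submanifold p L.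
Variables (e : 'rV[R]_m -> 'M[R]_(p, m)) (he : orthonormal_frame L e).
Implicit Types (V : set 'rV[R]_p) (phi : 'rV[R]_p -> 'rV[R]_m).

Lemma Ck_jacobian k V n' (f : 'rV[R]_p -> 'rV[R]_n') : open V ->
  Ck k.+1 V f -> Ck k V (fun a => lin1_mx ('d f a)).
Proof.
move=> oV [df Df]; apply: Ck_mx => // i j.
apply: (@Ck_eq _ _ _ oV _ _ (fun a => ('d f a (delta_mx 0 i)) 0 j)).
  by move=> a _; rewrite mxE.
exact: (Ck_coord oV 0 j (Df (delta_mx 0 i))).
Qed.

Definition tangent_proj (y : 'rV[R]_m) : 'M[R]_m := (e y)^T *m e y.

Definition normal_proj (xi y : 'rV[R]_m) : 'rV[R]_m :=
  xi *m (1%:M - tangent_proj y).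

Lemma Ck_tangent_proj k V phi : parametrization L V phi ->
  Ck k V (tangent_proj \o phi).
Proof.
move=> Hphi; have oV := param_open Hphi.
have CJ := Ck_jacobian oV (param_smooth Hphi k.+1).
have CJt : Ck k V (fun a => (lin1_mx ('d phi a))^T).
  apply: Ck_mx => // i j.
  apply: (@Ck_eq _ _ _ oV _ _ (fun a => (lin1_mx ('d phi a)) j i)).
    by move=> a _; rewrite [RHS]mxE.
  exact: (Ck_coord oV j i CJ).
apply: (@Ck_eq _ _ _ oV)
  (Ck_mulmx oV (Ck_mulmx oV CJt (Ck_invmx oV _ (Ck_mulmx oV CJ CJt))) CJ).
  by move=> a Va; rewrite /= /tangent_proj (frame_projE he Hphi Va).2.
by move=> a Va; exact: (frame_projE he Hphi Va).1.
Qed.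

Lemma normal_proj_field xi : normal_field p L (normal_proj xi).
Proof.
split=> [V phi Hphi k|x Lx].
  have oV := param_open Hphi.
  have C1 := Ck_cst oV k (1%:M : 'M[R]_m); have Cxi := Ck_cst oV k xi.
  have CP := Ck_tangent_proj k Hphi.
  have CN := CkD oV C1 (Ck_mulmx oV (Ck_cst oV k (- 1%:M : 'M[R]_m)) CP).
  apply: (@Ck_eq _ _ _ oV) (Ck_mulmx oV Cxi CN) => a Va.
  by rewrite /= /normal_proj mulNmx mul1mx.
apply/(normal_frameP hL he) => //.
rewrite /normal_proj /tangent_proj -mulmxA mulmxBl mul1mx -mulmxA.
by rewrite (frame_mulT he) // mulmx1 subrr mulmx0.
Qed.

Lemma normal_proj_id xi x : L x -> normal_at p L x xi -> normal_proj xi x = xi.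
Proof.
move=> Lx /(normal_frameP hL he xi Lx) xiE.
by rewrite /normal_proj /tangent_proj mulmxBr mulmx1 mulmxA xiE mul0mx subr0.
Qed.

Lemma tangential_partE x w : L x ->
  tangential_part p L x w = w *m (e x)^T *m e x.
Proof.
move=> Lx; have EE := frame_mulT he Lx; apply: get_unique.
  split.
    apply/(tangent_frameP hL he) => //.
    by rewrite -!mulmxA (mulmxA (e x)) EE mul1mx.
  apply/(normal_frameP hL he) => //.
  by rewrite mulmxBl -!mulmxA EE mulmx1 subrr.
move=> v [/(tangent_frameP hL he _ Lx) <- /(normal_frameP hL he _ Lx)].
rewrite mulmxBl => /eqP; rewrite subr_eq0 => /eqP ->.
by rewrite -(mulmxA _ (e x)) EE mulmx1.
Qed.

(** Pairing with a tangent vector forgets the normal part. From here on the second fundamental form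
    and the derivative of [mu] are both handled as [Bmx]. *)
Lemma AmxE nu x : L x -> Amx L e nu x = Bmx L e nu x.
Proof.
move=> Lx; apply/matrixP => i j.
rewrite !mxE /second_fundamental_form tangential_partE //.
have := (tangent_frameP hL he _ Lx).1 ((he Lx).1 j).
move: (nabla _ _ _ _ _) (row j (e x)) => w r rP.
by rewrite !dotE -[in RHS]rP !trmx_mul trmxK !mulmxA.
Qed.

(** The rows of [C] are the chart coordinates of the frame vectors. This matrix form serves to
    compute tangent spaces, and the entrywise [Bmx_dot] to prove symmetry. *)
Lemma BmxE f V phi a (C : 'M[R]_p) : smooth_along p L f ->
  parametrization L V phi -> V a -> e (phi a) = C *m lin1_mx ('d phi a) ->
  Bmx L e f (phi a) = C *m lin1_mx ('d (f \o phi) a) *m (e (phi a))^T.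
Proof.
move=> sf Hphi Va EC; apply/matrixP => i j.
have rE : row i (e (phi a)) = 'd phi a (row i C).
  by rewrite EC row_mul mul_rV_lin1.
have rN : nabla p L f (phi a) (row i (e (phi a))) =
    row i (C *m lin1_mx ('d (f \o phi) a)).
  apply: etrans (congr1 (nabla p L f (phi a)) rE) _.
  apply: etrans (nablaE (row i C) sf Hphi Va) _.
  apply: esym; apply: etrans (row_mul _ _ _) _.
  exact: (mul_rV_lin1 ('d (f \o phi) a)).
by rewrite [LHS]mxE (congr1 (fun v => dot v _) rN); exact: dot_row.
Qed.

Lemma Bmx_dot f V phi a (C : 'M[R]_p) i j : smooth_along p L f ->
  parametrization L V phi -> V a -> e (phi a) = C *m lin1_mx ('d phi a) ->
  Bmx L e f (phi a) i j =
  dot ('d (f \o phi) a (row i C)) ('d phi a (row j C)).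
Proof.
move=> sf Hphi Va EC.
have rE k : row k (e (phi a)) = 'd phi a (row k C).
  by rewrite EC row_mul mul_rV_lin1.
have rN : nabla p L f (phi a) (row i (e (phi a))) = 'd (f \o phi) a (row i C).
  apply: etrans (congr1 (nabla p L f (phi a)) (rE i)) _.
  exact: (nablaE (row i C) sf Hphi Va).
by rewrite [LHS]mxE; exact: (f_equal2 (@dot R m) rN (rE j)).
Qed.

Lemma second_diff_sym_rV n V (phi : 'rV[R]_p -> 'rV[R]_n) a u v :
  open V -> Ck 2 V phi -> V a ->
  'd (fun b => 'd phi b u) a v = 'd (fun b => 'd phi b v) a u.
Proof.
move=> oV [dphi Cphi] Va.
have near_V := open_nbhs_nbhs (conj oV Va).
have d2 w : differentiable (fun b => 'd phi b w) a by exact: (Cphi w).1.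
apply/rowP => k.
pose f y : R := phi y 0 k.
have df b : V b -> differentiable f b /\ forall w, 'd f b w = ('d phi b w) 0 k.
  move=> Vb; split=> [|w]; first exact: (diff_coord 0 0 k (dphi b Vb)).1.
  exact: (diff_coord w 0 k (dphi b Vb)).2.
have d2f w w' : differentiable (fun b => 'd f b w) a /\
    'd (fun b => 'd f b w) a w' = ('d (fun b => 'd phi b w) a w') 0 k.
  have [dk dkE] := diff_coord w' 0 k (d2 w).
  have nE : \forall b \near a, (fun y => ('d phi y w) 0 k : R) b = 'd f b w.
    by apply: filterS near_V => b Vb; rewrite (df b Vb).2.
  have [d dE] := near_eq_diff nE dk.
  split; first exact: d.
  exact: etrans (congr1 (fun h => h w') dE) dkE.
rewrite -(d2f u v).2 -(d2f v u).2.
apply: second_diff_sym; [|exact: (d2f u 0).1|exact: (d2f v 0).1].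
by apply: filterS near_V => b Vb; exact: (df b Vb).1.
Qed.

(** Differentiate the vanishing pairing of [nu] with ['d phi b (row j C)], where [row j C] is frozen
    as [b] moves. The derivative of [nu] is traded for its value at one point. *)
Lemma Bmx_normal nu V phi a (C : 'M[R]_p) i j : normal_field p L nu ->
  parametrization L V phi -> V a -> e (phi a) = C *m lin1_mx ('d phi a) ->
  Bmx L e nu (phi a) i j =
  - dot (nu (phi a)) ('d (fun b => 'd phi b (row j C)) a (row i C)).
Proof.
move=> [snu nnu] Hphi Va EC; rewrite (Bmx_dot i j snu Hphi Va EC).
have [dnu _] := snu _ _ Hphi 1%N.
have [_ Cphi] := param_smooth Hphi 2%N.
have d2 : differentiable (fun b => 'd phi b (row j C)) a.
  exact: (Cphi (row j C)).1.
have [_ dE] := diff_dot (row i C) (dnu a Va) d2.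
apply/eqP; rewrite -subr_eq0 opprK; apply/eqP; rewrite -dE.
have z : \forall b \near a,
    cst (0 : R) b = dot ((nu \o phi) b) ('d phi b (row j C)).
  apply: filterS (open_nbhs_nbhs (conj (param_open Hphi) Va)) => b Vb /=.
  apply/esym/nnu; first exact: parametrization_sub Hphi Vb.
  by apply/(tangentP _ Hphi Vb); exists (row j C).
have [_ h] := near_eq_diff z (differentiable_cst (0 : R) a).
exact: etrans (congr1 (fun h => h (row i C)) h)
              (congr1 (fun h => h (row i C)) (diff_cst (0 : R) a)).
Qed.

Lemma frame_chart x : L x -> exists V phi a C,
  [/\ parametrization L V phi, V a, phi a = x & e x = C *m lin1_mx ('d phi a)].
Proof.
move=> Lx; have [V [phi [a [Hphi Va ax]]]] := hL Lx.
have /submxP[C EC] : (e (phi a) <= lin1_mx ('d phi a))%MS.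
  by rewrite (frame_jacobian he Hphi Va).
by exists V, phi, a, C; split => //; rewrite -ax.
Qed.

Lemma Bmx_normal_sym nu x : normal_field p L nu -> L x ->
  (Bmx L e nu x)^T = Bmx L e nu x.
Proof.
move=> fnu Lx; have [V [phi [a [C [Hphi Va ax EC]]]]] := frame_chart Lx.
rewrite -ax in EC Lx *; apply/matrixP => i j; rewrite mxE.
apply: etrans (Bmx_normal j i fnu Hphi Va EC) _.
apply: etrans _ (esym (Bmx_normal i j fnu Hphi Va EC)).
apply: (congr1 (fun w => - dot (nu (phi a)) w)).
exact: second_diff_sym_rV (param_open Hphi) (param_smooth Hphi 2%N) Va.
Qed.

(** The three fields are related at [x] only; this suffices because [Bmx_normal] sees just their
    values there. *)
Lemma Bmx_normal_linear nu nu1 nu2 (t : R) x : normal_field p L nu ->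
  normal_field p L nu1 -> normal_field p L nu2 -> L x ->
  nu x = t *: nu1 x + nu2 x ->
  Bmx L e nu x = t *: Bmx L e nu1 x + Bmx L e nu2 x.
Proof.
move=> f0 f1 f2 Lx nuE.
have [V [phi [a [C [Hphi Va ax EC]]]]] := frame_chart Lx.
rewrite -ax in EC Lx nuE *; apply/matrixP => i j.
rewrite [RHS]mxE [X in _ = X + _]mxE.
have lin (u v w : 'rV[R]_m) : - dot (t *: u + v) w = t * - dot u w + - dot v w.
  by rewrite !dotE mulmxDl -scalemxAl !mxE opprD mulrN.
apply: etrans (Bmx_normal i j f0 Hphi Va EC) _.
apply: etrans _ (esym (f_equal2 (fun x y => t * x + y)
  (Bmx_normal i j f1 Hphi Va EC) (Bmx_normal i j f2 Hphi Va EC))).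
exact: etrans (congr1 (fun u => - dot u _) nuE) (lin _ _ _).
Qed.

(** The product rule splits the derivative of [pullback phi mu] into an entry of [Bmx] and a term
    with the second differential of [phi]. The latter is symmetric, so closedness says that the
    former is too. *)
Lemma Bmx_closed_sym mu x : one_form p L mu -> closed_form p L mu -> L x ->
  (Bmx L e mu x)^T = Bmx L e mu x.
Proof.
move=> [smu _] dmu Lx; have [V [phi [a [C [Hphi Va ax EC]]]]] := frame_chart Lx.
rewrite -ax in EC Lx *; apply/matrixP => i j; rewrite mxE.
apply: etrans (Bmx_dot j i smu Hphi Va EC) _.
apply: etrans _ (esym (Bmx_dot i j smu Hphi Va EC)).
have [dmuphi _] := smu _ _ Hphi 1%N.
have [_ Cphi] := param_smooth Hphi 2%N.
have d2 w : differentiable (fun b => 'd phi b w) a by exact: (Cphi w).1.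
have dE w v : 'D_v (fun b => pullback phi mu b w : R^o) a =
    dot ('d (mu \o phi) a v) ('d phi a w) +
    dot (mu (phi a)) ('d (fun b => 'd phi b w) a v).
  have [d1 d1E] := diff_dot v (dmuphi a Va) (d2 w).
  exact: etrans (deriveE v d1) d1E.
have cancel (x1 y1 x2 y2 : R) :
    x1 + y1 - (x2 + y2) = 0 -> y1 = y2 -> x1 = x2 by lra.
apply: cancel.
  apply: etrans (dmu _ _ Hphi a Va (row j C) (row i C)).
  exact: esym (f_equal2 (fun x y => x - y) (dE _ _) (dE _ _)).
apply: (congr1 (dot (mu (phi a)))).
exact: second_diff_sym_rV (param_open Hphi) (param_smooth Hphi 2%N) Va.
Qed.

End SecondFundamentalForm.

(** * Charts of the twisted conormal bundle *)

Section Directional.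
Variables (R : realType) (V V' W : normedModType R).

Lemma Ck_sub k (U U' : set V) (f : V -> W) : U `<=` U' -> Ck k U' f -> Ck k U f.
Proof.
move=> UU'; elim: k f => [|k IH] f /=; first by move=> cf x /UU'; exact: cf.
by move=> [df Df]; split=> [x /UU'|v]; [exact: df|apply: IH; exact: Df].
Qed.

Lemma Ck_linfun k (U : set V) (A : {linear V -> W}) :
  open U -> continuous A -> Ck k U A.
Proof.
move=> oU Ac; case: k => [|k]; first by move=> x _; exact: Ac.
split=> [x _|v]; first exact: linear_differentiable.
apply: (@Ck_eq _ _ _ oU _ _ (fun=> A v)) (Ck_cst oU k (A v)) => x _.
exact: (esym (congr1 (fun h => h v) (diff_lin x Ac))).
Qed.

Lemma diff_linear_postcomp (A : {linear V' -> W}) (f : V -> V') x v :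
  continuous A -> differentiable f x -> 'd (A \o f) x v = A ('d f x v).
Proof.
move=> Ac df; have := diff_comp df (linear_differentiable (f x) Ac).
by rewrite (diff_lin _ Ac) => /(congr1 (fun h => h v)).
Qed.

Lemma diff_linear_precomp (A : {linear V -> V'}) (f : V' -> W) x v :
  continuous A -> differentiable f (A x) -> 'd (f \o A) x v = 'd f (A x) (A v).
Proof.
move=> Ac df; have := diff_comp (linear_differentiable x Ac) df.
by rewrite (diff_lin _ Ac) => /(congr1 (fun h => h v)).
Qed.

Lemma diff_affine (f : V -> W) w h c : differentiable f w ->
  (forall t : R, f (t *: h + w) = t *: c + f w) -> 'd f w h = c.
Proof.
move=> df fE; rewrite -(deriveE _ df).
have idc : continuous (idfun : {linear W -> W}) by move=> x; exact: cvg_id.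
have := deriveE c (linear_differentiable (f w) idc).
rewrite (congr1 (fun k => k c) (diff_lin (f w) idc)) /= => <-.
apply: (congr1 (fun F : R -> W => lim (F @ 0^'))); apply/funext => t.
by rewrite /= fE.
Qed.

(** Compares directional derivatives of maps that agree only along a pair of lines, possibly in
    different spaces. *)
Lemma diff_along (f : V -> W) (g : V' -> W) w h b c :
  differentiable f w -> differentiable g b ->
  (forall t : R, f (t *: h + w) = g (t *: c + b)) -> 'd f w h = 'd g b c.
Proof.
move=> df dg fg; rewrite -(deriveE _ df) -(deriveE _ dg) /derive.
have fwb : f w = g b by have := fg 0; rewrite !scale0r !add0r.
apply: (congr1 (fun F : R -> W => lim (F @ 0^'))); apply/funext => t.
by rewrite /= fg fwb.
Qed.

End Directional.

Lemma open_unitmx (R : realType) (V : normedModType R) n (U : set V)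
    (f : V -> 'M[R]_n) : open U -> Ck 0 U f ->
  open [set x | U x /\ f x \in unitmx].
Proof.
move=> oU Cf; rewrite openE => x [Ux fx].
have cd := Ck_continuous (Ck_det oU Cf) Ux.
have dx : \det (f x) != 0 by move: fx; rewrite unitmxE unitfE.
have Hd : \forall y \near x, \det (f y) != 0.
  have nd : nbhs (\det (f x) : R) [set y : R | y != 0].
    by apply: open_nbhs_nbhs; split; [exact: open_neq|exact: dx].
  exact: cd nd.
have HH : nbhs x (U `&` (fun y => \det (f y) != 0)).
  by apply: filterI => //; exact: open_nbhs_nbhs (conj oU Ux).
suff H : (U `&` (fun y => \det (f y) != 0)) `<=`
    [set x | U x /\ f x \in unitmx].
  exact: filterS H HH.
move=> y [Uy dy].
by split => //; rewrite unitmxE unitfE.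
Qed.

(** Kato's intertwiner of two projections; both sides equal [P *m Q]. Acting on rows, [M] maps the
    kernel of [P] into that of [Q]. *)
Lemma mulmx_proj_intertwine (R : pzRingType) n (P Q : 'M[R]_n) :
  P *m P = P -> Q *m Q = Q ->
  let M := P *m Q + (1%:M - P) *m (1%:M - Q) in P *m M = M *m Q.
Proof.
move=> PK QK M.
have PM : P *m M = P *m Q.
  rewrite /M mulmxDr (mulmxA P P).
  rewrite PK (mulmxA P (1%:M - P)) (mulmxBr P) mulmx1 PK.
  by rewrite subrr mul0mx addr0.
rewrite PM /M mulmxDl -mulmxA QK -(mulmxA (1%:M - P)) (mulmxBl _ _ Q) mul1mx QK.
by rewrite subrr mulmx0 addr0.
Qed.

Lemma mulmx_proj_compl (R : pzRingType) n (P : 'M[R]_n) :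
  P *m P = P -> P *m P + (1%:M - P) *m (1%:M - P) = 1%:M.
Proof.
by move=> PK; rewrite mulmxBr mulmx1 mulmxBl mul1mx PK subrr subr0 addrC subrK.
Qed.

(** The algebra behind the tangent space of the twisted conormal bundle: on the left the image of
    the differential of a chart, on the right a row space written in the frame. The normal part of
    [K] is absorbed by the fibre directions, which fill the range of [1 - P]; only its tangential
    part [B] survives. *)
Lemma chart_image_mx (R : comNzRingType) n p (E J K : 'M[R]_(p, n))
    (C B : 'M[R]_p) (P : 'M[R]_n) :
  E *m E^T = 1%:M -> P = E^T *m E -> E = C *m J -> J *m P = J ->
  B = C *m K *m E^T -> forall v : 'rV[R]_(n + n),
  (exists h : 'rV_n,
     row_mx (h *m E^T *m J) (h *m E^T *m K + h *m (1%:M - P)) = v) <->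
  (exists g : 'rV_n, v = g *m row_mx P (E^T *m B *m E + (1%:M - P))).
Proof.
move=> EE PE EC JP BE v.
have PET : P *m E^T = E^T by rewrite PE -mulmxA EE mulmx1.
have PP : P *m P = P by rewrite {2}PE mulmxA PET -PE.
have NET w : w *m (1%:M - P) *m E^T = 0 :> 'rV_p.
  by rewrite -mulmxA mulmxBl mul1mx PET subrr mulmx0.
have NP w : w *m (1%:M - P) *m P = 0 :> 'rV_n.
  by rewrite -mulmxA mulmxBl mul1mx PP subrr mulmx0.
have NN w : w *m (1%:M - P) *m (1%:M - P) = w *m (1%:M - P) :> 'rV_n.
  by rewrite mulmxBr mulmx1 NP subr0.
have BEE : E^T *m B *m E = E^T *m C *m K *m P by rewrite BE PE !mulmxA.
have JEC : J *m E^T *m C = 1%:M by apply: mulmx1C; rewrite mulmxA -EC.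
split=> [[h <-]|[g ->]].
  (* The tangential part of [g] is read off from the base component [c *m J], its normal part from
     that of the fibre component. *)
  move: (h *m E^T) => c; pose u := c *m K + h.
  pose g := c *m J + u *m (1%:M - P).
  have JN : J *m (1%:M - P) = 0 by rewrite mulmxBr mulmx1 JP subrr.
  have gET : g *m E^T = c *m J *m E^T by rewrite mulmxDl NET addr0.
  have gN : g *m (1%:M - P) = u *m (1%:M - P).
    by rewrite mulmxDl -(mulmxA c) JN mulmx0 add0r NN.
  exists g; rewrite mul_mx_row; congr row_mx.
    by rewrite mulmxDl NP addr0 -mulmxA JP.
  have gC : g *m E^T *m C = c by rewrite gET -!mulmxA (mulmxA J) JEC mulmx1.
  rewrite (mulmxDr g) gN BEE !mulmxA gC /u (mulmxDl (c *m K)) addrA.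
  congr (_ + _).
  by rewrite (mulmxBr (c *m K)) mulmx1 addrC subrK.
pose c := g *m E^T *m C.
(* The tangential coordinates are [c]; the normal part of [g] is corrected by that of [c *m K],
   which the chart adds by itself. *)
exists (c *m E + (g - c *m K) *m (1%:M - P)).
have -> : (c *m E + (g - c *m K) *m (1%:M - P)) *m E^T = c.
  by rewrite mulmxDl NET addr0 -mulmxA EE mulmx1.
have EN : E *m (1%:M - P) = 0.
  by rewrite mulmxBr mulmx1 PE mulmxA EE mul1mx subrr.
rewrite mul_mx_row; congr row_mx.
  by rewrite /c -mulmxA -EC PE mulmxA.
rewrite mulmxDl NN -(mulmxA c) EN mulmx0 add0r mulmxBl addrCA mulmxDr addrC.
congr (_ + _).
by rewrite BEE !mulmxA -/c mulmxBr mulmx1 opprB addrC subrK.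
Qed.

Section TwistedConormal.
Variables (R : realType) (n p : nat) (L : set 'rV[R]_n).
Hypothesis hL : submanifold p L.
Variables (e : 'rV[R]_n -> 'M[R]_(p, n)) (he : orthonormal_frame L e).
Variables (mu : 'rV[R]_n -> 'rV[R]_n) (smu : smooth_along p L mu).

Local Notation P := (tangent_proj e).

Lemma tangent_projK x : L x -> P x *m P x = P x.
Proof.
move=> Lx; rewrite /tangent_proj !mulmxA -(mulmxA _^T).
by rewrite (frame_mulT he Lx) mulmx1.
Qed.

Lemma normal_projP x xi : L x -> normal_at p L x xi <-> xi *m P x = 0.
Proof.
move=> Lx; rewrite (normal_frameP hL he _ Lx) /tangent_proj mulmxA.
split=> [->|H]; first by rewrite mul0mx.
by rewrite -[LHS]mulmx1 -(frame_mulT he Lx) mulmxA H mul0mx.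
Qed.

Lemma twisted_conormalP z : twisted_conormal p L mu z <->
  L (lsubmx z) /\ (rsubmx z - mu (lsubmx z)) *m P (lsubmx z) = 0.
Proof.
split=> [[x [xi [Lx nxi ->]]]|[Lx nxi]].
  by rewrite row_mxKl row_mxKr addrK; split=> //; apply/normal_projP.
exists (lsubmx z), (rsubmx z - mu (lsubmx z)); split => //.
  exact/normal_projP.
by rewrite subrK hsubmxK.
Qed.

Section Chart.
Variables (V : set 'rV[R]_p) (phi : 'rV[R]_p -> 'rV[R]_n) (a0 : 'rV[R]_p).
Hypotheses (Hphi : parametrization L V phi) (Va0 : V a0).
Variable xi : 'rV[R]_n.
Hypothesis nxi : normal_at p L (phi a0) xi.

Let E := e (phi a0).
Let P0 := P (phi a0).
Let Q (a : 'rV[R]_p) := P (phi a).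

(* M a maps the normal space at phi a0 onto the one at phi a when invertible.
   A point w = a *m E + h of the domain of the chart gathers the coordinates a
   on L and a vector h normal to L at phi a0. *)
Let M (a : 'rV[R]_p) := P0 *m Q a + (1%:M - P0) *m (1%:M - Q a).
Let chart_dom : set 'rV[R]_n :=
  [set w | V (w *m E^T) /\ M (w *m E^T) \in unitmx].
Let chart (w : 'rV[R]_n) : 'rV[R]_(n + n) :=
  row_mx (phi (w *m E^T))
         (w *m (1%:M - P0) *m (1%:M - Q (w *m E^T)) + mu (phi (w *m E^T))).
Let w0 := a0 *m E + xi.

Let Lphi a : V a -> L (phi a).
Proof. exact: (parametrization_sub Hphi). Qed.

Let EE : E *m E^T = 1%:M.
Proof. exact: (frame_mulT he (Lphi Va0)). Qed.

Let QK a : V a -> Q a *m Q a = Q a.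
Proof. by move=> /Lphi; exact: tangent_projK. Qed.

Let P0K : P0 *m P0 = P0.
Proof. exact: QK Va0. Qed.

Let oV := param_open Hphi.

Let P0M a : V a -> P0 *m M a = M a *m Q a.
Proof.
by move=> Va; apply: mulmx_proj_intertwine; [exact: P0K|exact: QK].
Qed.

Let M0 : M a0 = 1%:M.
Proof. exact: mulmx_proj_compl P0K. Qed.

Let P0ET : P0 *m E^T = E^T.
Proof. by rewrite /P0 /tangent_proj -mulmxA EE mulmx1. Qed.

Let EP0 : E *m P0 = E.
Proof. by rewrite /P0 /tangent_proj mulmxA EE mul1mx. Qed.

Let xiP0 : xi *m P0 = 0.
Proof. by apply/normal_projP => //; exact: Lphi. Qed.

Let xiE : xi *m E^T = 0.
Proof. by apply/(normal_frameP hL he) => //; exact: Lphi. Qed.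

Let w0E : w0 *m E^T = a0.
Proof. by rewrite mulmxDl -mulmxA EE mulmx1 xiE addr0. Qed.

Let w0P : w0 *m (1%:M - P0) = xi.
Proof.
by rewrite mulmxBr mulmx1 mulmxDl -mulmxA EP0 xiP0 addr0 addrC addKr.
Qed.

Let w0_dom : chart_dom w0.
Proof. by rewrite /chart_dom /= w0E M0 unitmx1. Qed.

Let chart_w0 : chart w0 = row_mx (phi a0) (xi + mu (phi a0)).
Proof. by rewrite /chart w0E w0P /Q -/P0 mulmxBr mulmx1 xiP0 subr0. Qed.

Let CQ k : Ck k V Q.
Proof. exact: (Ck_tangent_proj he k Hphi). Qed.

Let C1Q k : Ck k V (fun a => 1%:M - Q a).
Proof.
apply: (@Ck_eq _ _ _ oV) (CkD oV (Ck_cst oV k (1%:M : 'M[R]_n))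
   (Ck_mulmx oV (Ck_cst oV k (- 1%:M : 'M[R]_n)) (@CQ k))) => a _.
by rewrite mulNmx mul1mx.
Qed.

Let CM k : Ck k V M.
Proof.
by apply: (@Ck_eq _ _ _ oV) (CkD oV (Ck_mulmx oV (Ck_cst oV k P0) (@CQ k))
  (Ck_mulmx oV (Ck_cst oV k (1%:M - P0)) (@C1Q k))) => a _.
Qed.

Let ET : {linear 'rV[R]_n -> 'rV[R]_p} := mulmxr E^T.

Let ETc : continuous ET.
Proof. exact: linear_mx_continuous. Qed.

Let oETV : open (ET @^-1` V).
Proof. by apply: open_comp => // x _; exact: ETc. Qed.

Let open_dom : open chart_dom.
Proof.
apply: (open_unitmx oETV (f := M \o ET)).
exact: Ck_precomp_linear oV ETc (@CM 0).
Qed.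

Let smooth_chart : smooth chart_dom chart.
Proof.
move=> k; apply: (@Ck_sub _ _ _ k _ (ET @^-1` V)); first by move=> w [].
have Cphi : Ck k (ET @^-1` V) (phi \o ET).
  exact: Ck_precomp_linear oV ETc (param_smooth Hphi k).
have Cmu : Ck k (ET @^-1` V) ((mu \o phi) \o ET).
  exact: Ck_precomp_linear oV ETc (smu Hphi k).
have CN : Ck k (ET @^-1` V) ((fun a => 1%:M - Q a) \o ET).
  exact: Ck_precomp_linear oV ETc (@C1Q k).
have Cw : Ck k (ET @^-1` V)
    (mulmxr (1%:M - P0) : {linear 'rV[R]_n -> 'rV[R]_n}).
  exact: (Ck_linfun k oETV (@linear_mx_continuous _ _ _ _ _)).
have C2 := CkD oETV (Ck_mulmx oETV Cw CN) Cmu.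
have C3 := CkD oETV
   (Ck_mulmx oETV Cphi (Ck_cst oETV k (row_mx 1%:M 0 : 'M[R]_(n, n + n))))
   (Ck_mulmx oETV C2 (Ck_cst oETV k (row_mx 0 1%:M : 'M[R]_(n, n + n)))).
apply: (@Ck_eq _ _ _ oETV) C3 => w _ /=.
by rewrite !mul_mx_row !mulmx1 !mulmx0 add_row_mx addr0 add0r.
Qed.

Let chart_lsub w : lsubmx (chart w) = phi (w *m E^T).
Proof. exact: row_mxKl. Qed.

Let chart_rsub w : rsubmx (chart w) =
  w *m (1%:M - P0) *m (1%:M - Q (w *m E^T)) + mu (phi (w *m E^T)).
Proof. exact: row_mxKr. Qed.

Let normal_M (u : 'rV[R]_n) a : u *m P0 = 0 -> u *m (1%:M - Q a) = u *m M a.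
Proof.
move=> uP; rewrite /M [RHS]mulmxDr (mulmxA u P0) uP mul0mx add0r.
by rewrite (mulmxA u (1%:M - P0)) (mulmxBr u 1%:M P0) uP subr0 mulmx1.
Qed.

Let projP0 (w : 'rV[R]_n) : w *m (1%:M - P0) *m P0 = 0.
Proof. by rewrite -mulmxA mulmxBl mul1mx P0K subrr mulmx0. Qed.

Let projET (w : 'rV[R]_n) : w *m (1%:M - P0) *m E^T = 0.
Proof. by rewrite -mulmxA mulmxBl mul1mx P0ET subrr mulmx0. Qed.

Let split_w (w : 'rV[R]_n) : w = w *m E^T *m E + w *m (1%:M - P0).
Proof. by rewrite -mulmxA mulmxBr mulmx1 addrC subrK. Qed.

Let chart_inj : {in chart_dom &, injective chart}.
Proof.
move=> w w'; rewrite !inE => -[Vw Mw] [Vw' Mw'] /eq_row_mx[pw qw].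
have ww' : w *m E^T = w' *m E^T by apply: (param_inj Hphi); rewrite ?inE.
move: qw; rewrite ww' => /addIr.
rewrite (normal_M _ (projP0 w)) (normal_M _ (projP0 w')).
move=> /(congr1 (fun v : 'rV_n => v *m invmx (M (w' *m E^T)))).
by rewrite /= !mulmxK // => qw; rewrite (split_w w) (split_w w') ww' qw.
Qed.

Let chart_immersion w : chart_dom w -> injective ('d chart w).
Proof.
move=> Ww; have [dchart _] := smooth_chart 1%N.
have dw := dchart _ Ww; have [Vw Mw] := Ww.
have dphi := parametrization_differentiable Hphi Vw.
suff ker h : 'd chart w h = 0 -> h = 0.
  move=> h h' hh'; apply/eqP; rewrite -subr_eq0; apply/eqP/ker.
  by rewrite linearB hh' subrr.
move=> h0.
have hE : h *m E^T = 0.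
  apply: (param_immersion Hphi Vw); rewrite linear0.
  have d1 := diff_linear_precomp h ETc (dphi : differentiable phi (ET w)).
  have d2 := diff_linear_postcomp h (@continuous_lsubmx _ 1 n n) dw.
  apply: etrans (esym d1) _.
  rewrite (_ : phi \o ET = lsubmx \o chart); last first.
    by apply/funext => y; rewrite /= chart_lsub.
  by apply: etrans d2 _; rewrite /= h0 linear0.
(* Since [h] has no tangential part, the base parameter [w *m E^T] is constant along [h], and the
   chart is affine in that direction. *)
have dE : 'd chart w h = row_mx 0 (h *m (1%:M - P0) *m (1%:M - Q (w *m E^T))).
  apply: diff_affine dw _ => t.
  rewrite /chart !mulmxDl -!scalemxAl hE scaler0 add0r.
  by rewrite scale_row_mx scaler0 add_row_mx add0r addrA.
have [_] : (0 : 'rV[R]_n) = 0 /\ 0 = h *m (1%:M - P0) *m (1%:M - Q (w *m E^T)).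
  by apply/eq_row_mx; rewrite -dE h0 row_mx0.
rewrite (normal_M _ (projP0 h)).
move=> /esym/(congr1 (fun v : 'rV_n => v *m invmx (M (w *m E^T)))).
by rewrite /= mulmxK // mul0mx => hP; rewrite (split_w h) hE hP mul0mx addr0.
Qed.

Let chart_sub w : chart_dom w -> twisted_conormal p L mu (chart w).
Proof.
move=> [Vw Mw]; apply/twisted_conormalP; rewrite chart_lsub chart_rsub addrK.
split; first exact: Lphi.
by rewrite -mulmxA mulmxBl mul1mx (QK Vw) subrr mulmx0.
Qed.

(** The base parameter and the fibre coordinate are separate arguments: the second is a continuous
    function of the point in the cotangent space, whereas the first is controlled only through the
    openness of [phi]. *)
Let inv_chart (z : 'rV[R]_p * 'rV[R]_n) : 'rV[R]_n :=
  z.1 *m E + (z.2 - mu (phi z.1)) *m invmx (M z.1).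

Let inv_chartE w : chart_dom w -> inv_chart (w *m E^T, rsubmx (chart w)) = w.
Proof.
move=> [Vw Mw]; rewrite /inv_chart /= chart_rsub addrK.
by rewrite (normal_M _ (projP0 w)) mulmxK.
Qed.

Let inv_chartK a eta : V a -> M a \in unitmx ->
  (eta - mu (phi a)) *m Q a = 0 ->
  chart (inv_chart (a, eta)) = row_mx (phi a) eta /\
  inv_chart (a, eta) *m E^T = a.
Proof.
move=> Va Ma nu.
set u := (eta - mu (phi a)) *m invmx (M a).
have uP : u *m P0 = 0.
  rewrite /u -mulmxA; have -> : invmx (M a) *m P0 = Q a *m invmx (M a).
    rewrite -[LHS](mulmxK Ma) -(mulmxA _ P0) (P0M Va) mulmxA.
    by rewrite mulVmx // mul1mx.
  by rewrite mulmxA nu mul0mx.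
have uE : u *m E^T = 0 by rewrite -P0ET mulmxA uP mul0mx.
have aE : inv_chart (a, eta) *m E^T = a.
  by rewrite /inv_chart /= mulmxDl -/u uE addr0 -mulmxA EE mulmx1.
split=> //; rewrite /chart aE; congr row_mx.
have -> : inv_chart (a, eta) *m (1%:M - P0) = u.
  rewrite /inv_chart /= -/u mulmxDl mulmxBr mulmx1 mulmxBr mulmx1 uP subr0.
  by rewrite -mulmxA EP0 subrr add0r.
by rewrite (normal_M a uP) /u mulmxKV // subrK.
Qed.

Let inv_dom : set ('rV[R]_p * 'rV[R]_n)%type :=
  [set z | V z.1 /\ M z.1 \in unitmx].

Let inv_chart_continuous z : inv_dom z ->
  nbhs z inv_dom /\ {for z, continuous inv_chart}.
Proof.
move=> Dz; pose VV := (fst : 'rV[R]_p * 'rV[R]_n -> 'rV[R]_p) @^-1` V.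
have fc : continuous (fst : {linear ('rV[R]_p * 'rV[R]_n)%type -> 'rV[R]_p}).
  by move=> y; exact: cvg_fst.
have sc : continuous (snd : {linear ('rV[R]_p * 'rV[R]_n)%type -> 'rV[R]_n}).
  by move=> y; exact: cvg_snd.
have oVV : open VV by apply: open_comp => // x _; exact: fc.
have CMz : Ck 0 VV (M \o fst) := Ck_precomp_linear oV fc (@CM 0).
have oD : open inv_dom := open_unitmx oVV CMz.
split; first exact: open_nbhs_nbhs (conj oD Dz).
have sub : inv_dom `<=` VV by move=> y [].
have CI : Ck 0 inv_dom (fun y => invmx (M y.1)).
  by apply: (Ck_invmx oD) (Ck_sub sub CMz) => y [].
have Cmu : Ck 0 inv_dom ((mu \o phi) \o fst).
  exact: Ck_sub sub (Ck_precomp_linear oV fc (smu Hphi 0)).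
have C2 := CkD oD (Ck_linfun 0 oD sc)
  (Ck_mulmx oD Cmu (Ck_cst oD 0 (- 1%:M : 'M[R]_n))).
have C3 := CkD oD (Ck_mulmx oD (Ck_linfun 0 oD fc) (Ck_cst oD 0 E))
  (Ck_mulmx oD C2 CI).
apply: (Ck_continuous (k := 0)) Dz; apply: (@Ck_eq _ _ _ oD) C3 => y _ /=.
by rewrite /inv_chart mulmxN mulmx1.
Qed.

Let chart_openmap (W : set 'rV[R]_n) : open W -> W `<=` chart_dom ->
  exists2 U : set 'rV[R]_(n + n), open U &
    chart @` W = twisted_conormal p L mu `&` U.
Proof.
move=> oW Wdom.
(* This is the largest candidate for [U], so it remains to show that each image point is interior to
   the set. *)
pose U := [set z : 'rV[R]_(n + n) |
  twisted_conormal p L mu z -> (chart @` W) z]^°%classic.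
exists U; first exact: open_interior.
apply/seteqP; split=> z; last by move=> [Xz /nbhs_singleton]; exact.
move=> [w Ww <-]; split; first exact/chart_sub/Wdom.
have [Vw Mw] := Wdom _ Ww.
have [nD ic] := @inv_chart_continuous (w *m E^T, rsubmx (chart w)) (conj Vw Mw).
have nW : nbhs (inv_chart (w *m E^T, rsubmx (chart w))) W.
  by rewrite inv_chartE; [exact: open_nbhs_nbhs (conj oW Ww)|exact: Wdom].
(* On [A] times [H] the explicit inverse takes values in [W]. The open set [UA] below forces the
   base parameter of a nearby point of the bundle into [A]. *)
have [[A H] /= [nA nH] AH] := filterI nD (ic _ nW).
have : nbhs (w *m E^T) (A `&` V).
  by apply: filterI => //; exact: open_nbhs_nbhs (conj oV Vw).
rewrite nbhsE /= => -[A' [oA' A'w] A'A].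
have [|UA oUA UAE] := param_openmap Hphi oA'; first by move=> y /A'A[].
have UAw : UA (lsubmx (chart w)).
  rewrite chart_lsub; have [] // : (L `&` UA) (phi (w *m E^T)).
  by rewrite -UAE; exists (w *m E^T).
have n1 : \forall z \near chart w, UA (lsubmx z).
  have nUA := open_nbhs_nbhs (conj oUA UAw).
  exact: (@continuous_lsubmx _ 1 n n (chart w) _ nUA).
have n2 : \forall z \near chart w, H (rsubmx z).
  exact: (@continuous_rsubmx _ 1 n n (chart w) _ nH).
suff sub : (fun z => UA (lsubmx z)) `&` (fun z => H (rsubmx z)) `<=`
    [set z | twisted_conormal p L mu z -> (chart @` W) z].
  exact: filterS sub (filterI n1 n2).
move=> y [y1 y2] /twisted_conormalP[Ly ny].
have : (L `&` UA) (lsubmx y) by [].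
rewrite -UAE => -[a A'a ay]; rewrite -ay in ny.
have [Aa Va] := A'A _ A'a; have [[/= _ Ma] Wa] := AH (a, rsubmx y) (conj Aa y2).
have [cy _] := inv_chartK Va Ma ny.
by exists (inv_chart (a, rsubmx y)) => //; rewrite cy ay hsubmxK.
Qed.

Let chart_parametrization :
  parametrization (twisted_conormal p L mu) chart_dom chart.
Proof.
split; [exact: open_dom|exact: smooth_chart|exact: chart_immersion
       |exact: chart_inj|exact: chart_openmap].
Qed.

Let nu := normal_proj e xi.
Let J := lin1_mx ('d phi a0).
Let K := lin1_mx ('d (nu \o phi) a0) + lin1_mx ('d (mu \o phi) a0).

(** Split [h] by [split_w]. In normal directions the chart is affine. In tangential ones the normal
    part of the argument stays [xi], so along the line the chart agrees with the section [Phi] given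
    by [nu + mu] over [phi]. *)
Let diff_chart h :
  'd chart w0 h = row_mx (h *m E^T *m J) (h *m E^T *m K + h *m (1%:M - P0)).
Proof.
have [dchart _] := smooth_chart 1%N; have dw := dchart _ w0_dom.
have dphi := parametrization_differentiable Hphi Va0.
have dnu : differentiable (nu \o phi) a0.
  by have [dn _] := (normal_proj_field hL he xi).1 _ _ Hphi 1%N; exact: dn.
have dmu : differentiable (mu \o phi) a0.
  by have [dn _] := smu Hphi 1%N; exact: dn.
have E1 : 'd chart w0 (h *m (1%:M - P0)) = row_mx 0 (h *m (1%:M - P0)).
  have hE := projET h; have hP := projP0 h.
  move: (h *m (1%:M - P0)) hE hP => h' hE hP.
  apply: diff_affine dw _ => t; rewrite chart_w0.
  have X1 : (t *: h' + w0) *m E^T = a0.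
    by rewrite mulmxDl -scalemxAl hE scaler0 add0r w0E.
  have X2 : (t *: h' + w0) *m (1%:M - P0) = t *: h' + xi.
    by rewrite mulmxDl -scalemxAl w0P mulmxBr mulmx1 hP subr0.
  have X3 : (t *: h' + xi) *m (1%:M - P0) = t *: h' + xi.
    by rewrite mulmxBr mulmx1 mulmxDl -scalemxAl hP scaler0 xiP0 add0r subr0.
  rewrite /chart X1 X2 /Q -/P0 X3.
  by rewrite scale_row_mx scaler0 add_row_mx add0r addrA.
pose A1 : {linear 'rV[R]_n -> 'rV[R]_(n + n)} := mulmxr (row_mx 1%:M 0).
pose A2 : {linear 'rV[R]_n -> 'rV[R]_(n + n)} := mulmxr (row_mx 0 1%:M).
have A1c : continuous A1 by exact: linear_mx_continuous.
have A2c : continuous A2 by exact: linear_mx_continuous.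
have lin x y z : A1 x + (A2 y + A2 z) = row_mx x (y + z).
  rewrite /A1 /A2 /= !mul_mx_row !mulmx1 !mulmx0 !add_row_mx.
  by rewrite !addr0 !add0r.
pose Phi : 'rV[R]_p -> 'rV[R]_(n + n) :=
  (A1 \o phi) + ((A2 \o (nu \o phi)) + (A2 \o (mu \o phi))).
have d1 := differentiable_comp dphi (linear_differentiable (phi a0) A1c).
have d2 := differentiable_comp dnu (linear_differentiable (nu (phi a0)) A2c).
have d3 := differentiable_comp dmu (linear_differentiable (mu (phi a0)) A2c).
have dPhi : differentiable Phi a0.
  exact: (differentiableD d1 (differentiableD d2 d3)).
have PhiE : 'd Phi a0 (h *m E^T) = row_mx (h *m E^T *m J) (h *m E^T *m K).
  have D1 := congr1 (fun k => k (h *m E^T)) (diffD d1 (differentiableD d2 d3)).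
  have D2 := congr1 (fun k => k (h *m E^T)) (diffD d2 d3).
  apply: etrans D1 _; apply: etrans (congr1 (+%R _) D2) _.
  apply: etrans (f_equal2 +%R (diff_linear_postcomp _ A1c dphi)
   (f_equal2 +%R (diff_linear_postcomp _ A2c dnu)
                 (diff_linear_postcomp _ A2c dmu))) _.
  apply: etrans (lin _ _ _) _.
  rewrite /K mulmxDr; apply: esym; apply: (f_equal2 (@row_mx R 1 n n)).
    exact: (mul_rV_lin1 ('d phi a0)).
  exact: (f_equal2 +%R (mul_rV_lin1 ('d (nu \o phi) a0) _)
                       (mul_rV_lin1 ('d (mu \o phi) a0) _)).
have E2 : 'd chart w0 (h *m E^T *m E) = row_mx (h *m E^T *m J) (h *m E^T *m K).
  apply: etrans PhiE; apply: diff_along dw dPhi _ => t.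
  move: (h *m E^T) => c.
  have Y1 : (t *: (c *m E) + w0) *m E^T = t *: c + a0.
    by rewrite mulmxDl -scalemxAl -mulmxA EE mulmx1 w0E.
  have Y2 : (t *: (c *m E) + w0) *m (1%:M - P0) = xi.
    rewrite mulmxDl -scalemxAl -(mulmxA c) mulmxBr mulmx1 EP0 subrr mulmx0.
    by rewrite scaler0 add0r w0P.
  by apply: etrans _ (esym (lin _ _ _)); rewrite /chart Y1 Y2.
apply: etrans (congr1 ('d chart w0) (split_w h)) _.
apply: etrans (linearD _ _ _) _; apply: etrans (f_equal2 +%R E2 E1) _.
by rewrite add_row_mx addr0.
Qed.

Let B := Bmx L e nu (phi a0) + Bmx L e mu (phi a0).

Lemma twisted_tangentP v :
  tangent n (twisted_conormal p L mu) (row_mx (phi a0) (xi + mu (phi a0))) v <->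
  exists g, v = g *m row_mx P0 (E^T *m B *m E + (1%:M - P0)).
Proof.
have EJ := frame_jacobian he Hphi Va0; rewrite -/E -/J in EJ.
have /submxP[C EC] : (E <= J)%MS by rewrite EJ.
have JP : J *m P0 = J.
  have /submxP[D ->] : (J <= E)%MS by rewrite EJ.
  by rewrite -mulmxA EP0.
have BE : B = C *m K *m E^T.
  rewrite /B (BmxE (normal_proj_field hL he xi).1 Hphi Va0 EC).
  rewrite (BmxE smu Hphi Va0 EC).
  by rewrite -mulmxDl -mulmxDr.
rewrite -chart_w0 (tangentP _ chart_parametrization w0_dom).
have H := chart_image_mx EE (erefl _ : P0 = E^T *m E) EC JP BE v.
apply: iff_trans H.
split=> -[h hv]; exists h; first exact: etrans (esym (diff_chart h)) hv.
exact: etrans (diff_chart h) hv.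
Qed.

Lemma twisted_conormal_chart :
  exists (W : set 'rV[R]_n) (Psi : 'rV[R]_n -> 'rV[R]_(n + n)) w,
  [/\ parametrization (twisted_conormal p L mu) W Psi, W w &
      Psi w = row_mx (phi a0) (xi + mu (phi a0))].
Proof.
exists chart_dom, chart, w0.
by split; [exact: chart_parametrization|exact: w0_dom|exact: chart_w0].
Qed.

End Chart.

End TwistedConormal.

(** * The special Lagrangian condition *)

Section Expi.
Variable R : realType.

Lemma expiD (a b : R) : expi (a + b) = expi a * expi b.
Proof.
rewrite /expi cosD sinD; apply/eqP; rewrite eq_complex /=.
by rewrite eqxx /= addrC.
Qed.

Lemma expi_pihalf q : expi (pi / 2 * q%:R) = 'i%C ^+ q :> R[i].
Proof.
elim: q => [|q IH].
  by rewrite mulr0 expr0 /expi cos0 sin0.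
by rewrite -(natr1 q) mulrDr mulr1 expiD IH exprSr /expi cos_pihalf sin_pihalf.
Qed.

Lemma expi_neq0 (a : R) : expi a != 0.
Proof.
rewrite /expi eq_complex /=; apply/negP => /andP[/eqP c0 /eqP s0].
have := cos2Dsin2 a; rewrite c0 s0 expr0n addr0 => /eqP.
by rewrite eq_sym oner_eq0.
Qed.

End Expi.

Lemma omegaE (R : realType) n (u v : 'rV[R]_(n + n)) :
  omega u v = dot (lsubmx u) (rsubmx v) - dot (rsubmx u) (lsubmx v).
Proof. by rewrite /omega /dot -sumrB. Qed.

Section Main.
Variables (R : realType) (n p : nat) (L : set 'rV[R]_n).
Hypothesis hL : submanifold p L.
Variables (mu : 'rV[R]_n -> 'rV[R]_n) (hmu : one_form p L mu).
Variables (e : 'rV[R]_n -> 'M[R]_(p, n)) (he : orthonormal_frame L e).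

Let X := twisted_conormal p L mu.
Let S xi x := Bmx L e (normal_proj e xi) x + Bmx L e mu x.
Let fibre xi x : 'rV[R]_(n + n) := row_mx x (xi + mu x).
Let Y xi x := (e x)^T *m S xi x *m e x + (1%:M - (e x)^T *m e x).

Lemma twisted_tangent xi x v : L x -> normal_at p L x xi ->
  tangent n X (fibre xi x) v <->
  exists g, v = g *m row_mx ((e x)^T *m e x) (Y xi x).
Proof.
move=> Lx nxi; have [V [phi [a [C [Hphi Va ax _]]]]] := frame_chart hL he Lx.
rewrite -ax in Lx nxi *.
exact: (twisted_tangentP hL he hmu.1 Hphi Va nxi v).
Qed.

Lemma twisted_submanifold : submanifold n X.
Proof.
move=> _ [x [xi [Lx nxi ->]]].
have [V [phi [a [C [Hphi Va ax _]]]]] := frame_chart hL he Lx.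
rewrite -ax in Lx nxi *.
have [W [Psi [w [H1 H2 H3]]]] := twisted_conormal_chart hL he hmu.1 Hphi Va nxi.
by exists W, Psi, w.
Qed.

(** On the rows [(g P, g Z)] the form is [g (P Z - Z P) g'^T], by symmetry of [P] and [Z]; and [Z]
    commutes with [P]. *)
Lemma twisted_lagrangian : closed_form p L mu -> lagrangian X.
Proof.
move=> dmu; split; first exact: twisted_submanifold.
move=> _ [x [xi [Lx nxi ->]]] u v /(twisted_tangent _ Lx nxi)[g ->].
move=> /(twisted_tangent _ Lx nxi)[g' ->].
have EE := frame_mulT he Lx.
have ST : (S xi x)^T = S xi x.
  apply: etrans (linearD _ _ _) _.
  exact: (f_equal2 +%R (Bmx_normal_sym hL he (normal_proj_field hL he xi) Lx)
                       (Bmx_closed_sym hL he hmu dmu Lx)).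
rewrite omegaE !mul_mx_row !row_mxKl !row_mxKr !dotE /Y.
move: (S xi x) ST => T TT; move: (e x) EE => E EE.
set Z := E^T *m T *m E + _.
have PT : (E^T *m E)^T = E^T *m E by rewrite trmx_mul trmxK.
have ZT : Z^T = Z.
  by rewrite /Z !linearD linearN /= !trmx_mul !trmxK TT trmx1 mulmxA.
have PZ : E^T *m E *m Z = E^T *m T *m E.
  rewrite /Z mulmxDr mulmxBr mulmx1 !mulmxA.
  by rewrite -(mulmxA E^T E) EE mulmx1 subrr addr0.
have ZP : Z *m (E^T *m E) = E^T *m T *m E.
  by rewrite -[LHS]trmxK trmx_mul PT ZT PZ !trmx_mul trmxK TT mulmxA.
rewrite !(trmx_mul g') PT ZT; move: (E^T *m E) PZ ZP => P PZ ZP.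
by rewrite !mulmxA -(mulmxA g P) PZ -(mulmxA g Z) ZP subrr.
Qed.

(** Arbitrary tangent vectors contribute only the real factor [\det G], possibly zero, so the phase
    condition at a point can be tested on one family. *)
Lemma Omega_twisted xi x (v : 'I_n -> 'rV[R]_(n + n)) (G : 'M[R]_n) :
  (p <= n)%N -> L x ->
  (forall j, v j = row j G *m row_mx ((e x)^T *m e x) (Y xi x)) ->
  Omega v =
  (\det G)%:C%C * ('i%C ^+ (n - p) * \det (1%:M + 'i%C *: toC (S xi x))).
Proof.
move=> pn Lx vE; have EE := frame_mulT he Lx.
pose c := @map_mx _ _ (real_complex R).
have EEc : c _ _ (e x) *m c _ _ (e x)^T = 1%:M.
  by rewrite /c -map_mxM EE map_mx1.
rewrite -(det_twisted pn (toC (S xi x)) EEc) -det_map_mx -det_mulmx.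
pose Pm := (e x)^T *m e x.
have -> : c _ _ (e x)^T *m c _ _ (e x) +
    'i%C *: (c _ _ (e x)^T *m toC (S xi x) *m c _ _ (e x) +
             (1%:M - c _ _ (e x)^T *m c _ _ (e x))) =
    toC Pm + 'i%C *: toC (Y xi x).
  rewrite /toC /Y /Pm /c; move: (S xi x) => T.
  by rewrite map_mxD map_mxB !map_mxM map_mx1.
rewrite /Omega; apply: etrans (esym (det_tr _)) _; congr (\det _).
rewrite mulmxDr -scalemxAr -!map_mxM; apply/matrixP => j k.
have rowE (M : 'M[R]_n) : (row j G *m M) 0 k = (G *m M) j k.
  by rewrite -row_mul mxE.
rewrite [LHS]mxE [LHS]mxE /zcoord vE mul_mx_row row_mxKl row_mxKr !rowE -/Pm.
move: (G *m Pm) (G *m Y xi x) => A1 A2; rewrite !mxE.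
exact: (complexE (A1 j k +i* A2 j k)%C).
Qed.

Lemma special_lagrangianP (theta : R) : (p <= n)%N -> closed_form p L mu ->
  special_lagrangian theta X <->
  forall x xi, L x -> normal_at p L x xi ->
    complex.Im (expi (pi / 2 * (n - p)%:R - theta) *
                \det (1%:M + 'i%C *: toC (S xi x))) = 0.
Proof.
move=> pn dmu; have expiE : expi (pi / 2 * (n - p)%:R - theta) =
    expi (- theta) * 'i%C ^+ (n - p) by rewrite addrC expiD expi_pihalf.
rewrite expiE; split=> [[_ H] x xi Lx nxi|H].
  pose v (j : 'I_n) :=
    row j (1%:M : 'M[R]_n) *m row_mx ((e x)^T *m e x) (Y xi x).
  have Xz : X (fibre xi x) by exists x, xi.
  have := H _ Xz v.
  rewrite (Omega_twisted pn Lx (fun=> erefl)) det1 mul1r mulrA; apply.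
  by move=> j; apply/twisted_tangent => //; exists (row j 1%:M).
split; first exact: twisted_lagrangian.
move=> _ [x [xi [Lx nxi ->]]] v tv.
have [g vE] := choice (fun j => (twisted_tangent (v j) Lx nxi).1 (tv j)).
have vE' j : v j = row j (\matrix_j g j) *m row_mx ((e x)^T *m e x) (Y xi x).
  by rewrite rowK.
have ImZ (r : R) (z : R[i]) : complex.Im (r%:C%C * z) = r * complex.Im z.
  by case: z => a b /=; rewrite mul0r addr0.
by rewrite (Omega_twisted pn Lx vE') mulrCA ImZ mulrA (H x xi Lx nxi) mulr0.
Qed.

Lemma Bmx_normal_proj_scale nu t x : normal_field p L nu -> L x ->
  Bmx L e (normal_proj e (t *: nu x)) x = t *: Bmx L e nu x.
Proof.
move=> fnu Lx; have f0 := normal_proj_field hL he 0.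
have z0 : normal_proj e 0 x = 0 by rewrite /normal_proj mul0mx.
(* Linearity with [t = 1] and three zero fields makes this matrix equal to its double; the zero
   field then fills the second summand in the scaling argument. *)
have B0 : Bmx L e (normal_proj e 0) x = 0.
  have := Bmx_normal_linear hL he (t := 1) f0 f0 f0 Lx.
  rewrite z0 scaler0 addr0 scale1r => /(_ erefl)/eqP.
  by rewrite -subr_eq0 opprD addNKr oppr_eq0 => /eqP.
have fxi := normal_proj_field hL he (t *: nu x).
rewrite (Bmx_normal_linear hL he (t := t) fxi fnu f0 Lx).
  by rewrite B0 addr0.
rewrite z0 addr0; apply: (normal_proj_id hL he Lx).
by move=> w tw; rewrite dotE -scalemxAl mxE -dotE (fnu.2 x Lx w tw) mulr0.
Qed.

End Main.

Unset Implicit Arguments.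

Theorem theorem2p3 (R : realType) (n p : nat) (hpn : (p <= n)%N)
    (L : set 'rV[R]_n) (hL : submanifold p L)
    (mu : 'rV[R]_n -> 'rV[R]_n) (hmu : one_form p L mu)
    (hdmu : closed_form p L mu)
    (e : 'rV[R]_n -> 'M[R]_(p, n)) (he : orthonormal_frame L e)
    (theta : R) :
  let q := (n - p)%N in
  let phi := pi / 2 * q%:R - theta in
  special_lagrangian theta (twisted_conormal p L mu) <->
  (forall x, L x ->
     let iB : 'M[R[i]]_p := 'i%C *: toC (Bmx L e mu x) in
     complex.Im (expi phi * \det (1%:M + iB)) = 0 /\
     (forall nu, normal_field p L nu ->
        let A : 'M[R[i]]_p := toC (Amx L e nu x) in
        forall j : nat, (1 <= j <= p)%N ->
          sigma j (A *m invmx (1%:M + iB)) =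
          (-1) ^+ j * sigma j (A *m invmx (1%:M - iB)))).
Proof.
move=> q phi; rewrite (special_lagrangianP hL hmu he theta hpn hdmu).
have BT x := Bmx_closed_sym hL he hmu hdmu (x := x).
split=> [H x Lx iB|H x xi Lx nxi].
  (* Each [t *: nu x] is again normal at [x], so the phase condition holds along the whole line, as
     [Im_det_sigma] requires. *)
  have main nu (fnu : normal_field p L nu) :
      complex.Im (expi phi * \det (1%:M + iB)) = 0 /\
      (forall j : nat, (1 <= j <= p)%N ->
        sigma j (toC (Bmx L e nu x) *m invmx (1%:M + iB)) =
        (-1) ^+ j * sigma j (toC (Bmx L e nu x) *m invmx (1%:M - iB))).
    apply/(Im_det_sigma _ (expi_neq0 _) (BT x Lx)) => t.
    rewrite -(Bmx_normal_proj_scale hL he t fnu Lx); apply: H => // w tw.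
    by rewrite dotE -scalemxAl mxE -dotE (fnu.2 x Lx w tw) mulr0.
  (* The first condition does not involve [nu]; the projection of the zero vector supplies a normal
     field from which to extract it. *)
  split; first exact: (main _ (normal_proj_field hL he 0)).1.
  move=> nu fnu A j hj; rewrite /A (AmxE hL he nu Lx); exact: (main nu fnu).2.
have fxi := normal_proj_field hL he xi.
have [H0 Hj] := H x Lx.
(* Conversely, [xi] is extended to the normal field [normal_proj e xi], and the vanishing polynomial
   is evaluated at [t = 1]. *)
have := (Im_det_sigma (Bmx L e (normal_proj e xi) x) (expi_neq0 phi)
                      (BT x Lx)).2.
move=> /(_ _)/(_ 1); rewrite scale1r; apply; split=> // j hj.
by have := Hj _ fxi j hj; rewrite (AmxE hL he _ Lx).
Qed.
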